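(* Let $n,k\geq 2$ be integers. Let $P\in \mathbb{R}[X_1,\dots,X_n]$ be a polynomial of degree $k$ whose leading form (homogeneous part of degree $k$) is \[ P_k= Q_k+X_1Q_{k-1}+X_1^2Q_{k-2}+\cdots +X_1^kQ_0, \] where $Q_{k-i}\in \mathbb{R}[X_2,\dots,X_n]$ is a form of degree $k-i$ for all $0\leq i\leq k$. Suppose there are an integer $2\leq d\leq k$ and a proper (possibly empty) subset $\Sigma=\{X_{i_1},\dots,X_{i_m}\}\subsetneq \{X_2,\dots,X_n\}$ such that $Q_{k-i}\in \mathbb{R}[X_{i_1},\dots,X_{i_m}]$ for all $2\leq i \leq d-1$, and such that $Q_{k-1}$ contains (with nonzero coefficient) a monomial involving only variables of the complement $\{X_2,\dots,X_n\}\setminus \Sigma$. Define $s_d=\frac{d-1}{2d}$ and $s_\infty=\frac12$. Let $s\in\mathbb{R}$ and suppose there exists a constant $C_s$ such that \[ \Big\|\sup_{0<t<1}|T_t^Pf|\Big\|_{L^1(B_n(0,1))} \leq C_s \|f\|_{H^s(\mathbb{R}^n)}\qquad \text{for all } f\in H^s(\mathbb{R}^n). \] Then $s\geq s_\infty$ if $Q_{k-i}$ is identically zero for all $d\leq i \leq k$, and otherwise $s\geq s_{d}$.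
   Context: A form of degree $e$ is a homogeneous polynomial of degree $e$; the zero polynomial is allowed. The Fourier transform is $\hat f(\xi)=\int_{\mathbb{R}^n} f(x)e^{-ix\cdot\xi}\,dx$. For a real polynomial $P$ in $n$ variables, define \[ T_t^{P}f(x) = \frac{1}{(2\pi)^n} \int_{\mathbb{R}^n} \hat{f}(\xi) e^{i(x\cdot \xi + P(\xi)t)}\,d\xi , \] initially for $f$ of Schwartz class on $\mathbb{R}^n$ (and extended to $H^s$ as the Fourier multiplier $e^{iP(\xi)t}$). The Sobolev space $H^s(\mathbb{R}^n)$ consists of all tempered distributions $f$ with finite norm given by $\|f\|_{H^s(\mathbb{R}^n)}^2=(2\pi)^{-n}\int_{\mathbb{R}^n}(1+|\xi|^2)^s|\hat f(\xi)|^2\,d\xi$. $B_n(0,1)$ is the unit ball in $\mathbb{R}^n$ centered at the origin. *)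

(* Defs.v *)
From HB Require Import structures.
From mathcomp Require Import all_boot all_order all_algebra.
From mathcomp Require Import -(notations) mpoly.
From mathcomp Require Import all_classical all_reals all_analysis.
From mathcomp Require Import measurable_realfun complex.

Set Implicit Arguments.
Unset Strict Implicit.
Unset Printing Implicit Defensive.

Import Order.TTheory GRing.Theory Num.Theory.
Import numFieldNormedType.Exports.

Local Open Scope classical_set_scope.
Local Open Scope ring_scope.

(* Points of R^n are n-tuples, with the library's product sigma-algebra. *)
Notation Rn R n := (n.-tuple (measurableTypeR R)).

Section lebesgue_Rn.
Variable R : realType.
Local Open Scope ereal_scope.

Let cons_Rn n (p : measurableTypeR R * Rn R n) : Rn R n.+1 :=
  [the n.+1.-tuple (measurableTypeR R) of p.1 :: p.2].

Let measurable_cons_Rn n : measurable_fun [set: _] (@cons_Rn n).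
Proof. by apply: measurable_cons. Qed.

Section step.
Variables (n : nat) (m : {sigma_finite_measure set (Rn R n) -> \bar R}).

Definition lebesgue_cons : set (Rn R n.+1) -> \bar R :=
  pushforward (@lebesgue_measure R \x m) (@cons_Rn n).

Let lebesgue_cons0 : lebesgue_cons set0 = 0.
Proof. by rewrite /lebesgue_cons /pushforward preimage_set0 measure0. Qed.

Let lebesgue_cons_ge0 A : 0 <= lebesgue_cons A.
Proof. exact: (@measure_ge0 _ _ _ (@lebesgue_measure R \x m)). Qed.

Let lebesgue_cons_sigma_additive : semi_sigma_additive lebesgue_cons.
Proof.
move=> F mF tF mUF; rewrite /lebesgue_cons /pushforward preimage_bigcup.
apply: (@measure_semi_sigma_additive _ _ _ (@lebesgue_measure R \x m)).
- by move=> k; rewrite -[X in measurable X]setTI; exact: measurable_cons_Rn.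
- apply/trivIsetP => /= i j _ _ ij; rewrite -preimage_setI.
  by move/trivIsetP : tF => /(_ _ _ _ _ ij) ->//; rewrite preimage_set0.
- rewrite -preimage_bigcup -[X in measurable X]setTI.
  exact: measurable_cons_Rn.
Qed.

HB.instance Definition _ := isMeasure.Build _ _ _ lebesgue_cons
  lebesgue_cons0 lebesgue_cons_ge0 lebesgue_cons_sigma_additive.

Let lebesgue_cons_sigma_finite : sigma_finite setT lebesgue_cons.
Proof.
have /sigma_finiteP[F [TF ndF Foo]] := sigma_finiteT (@lebesgue_measure R).
have /sigma_finiteP[G [TG ndG Goo]] := sigma_finiteT m.
pose g (x : Rn R n.+1) : measurableTypeR R * Rn R n :=
  (tnth x ord0, [tuple of behead x]).
have cK p : g (cons_Rn p) = p.
  by case: p => x t; rewrite /g; congr pair; apply: val_inj.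
have mg : measurable_fun setT g.
  apply: (measurable_fun_pair (f := fun x : Rn R n.+1 => tnth x ord0)).
    exact: measurable_tnth.
  exact: measurable_behead.
exists (fun k => g @^-1` (F k `*` G k)).
  apply/esym/seteqP; split => // x _.
  have : (\bigcup_i F i) (g x).1 by rewrite -TF.
  move=> [i _ Fi]; have : (\bigcup_i G i) (g x).2 by rewrite -TG.
  move=> [j _ Gj]; exists (maxn i j) => //; split.
    by move: Fi; exact/subsetPset/ndF/leq_maxl.
  by move: Gj; exact/subsetPset/ndG/leq_maxr.
move=> k; have [mFk Fk] := Foo k; have [mGk Gk] := Goo k; split.
  by rewrite -[X in measurable X]setTI; apply: mg => //; exact: measurableX.
rewrite /lebesgue_cons /pushforward (_ : _ @^-1` _ = F k `*` G k).
  by rewrite product_measure1E// lte_mul_pinfty// ge0_fin_numE.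
by apply/funext => p; rewrite -[in RHS](cK p).
Qed.

HB.instance Definition _ := Measure_isSigmaFinite.Build _ _ _ lebesgue_cons
  lebesgue_cons_sigma_finite.

End step.

(* Lebesgue measure on R^n, as the n-fold product of the one on R. *)
Fixpoint lebesgue_Rn n : {sigma_finite_measure set (Rn R n) -> \bar R} :=
  match n with
  | 0 => \d_ [tuple]
  | n'.+1 => lebesgue_cons (lebesgue_Rn n')
  end.

End lebesgue_Rn.

Section euclidean.
Variables (R : realType) (n : nat).
Implicit Types x y : Rn R n.

Definition dot x y : R := \sum_(i < n) (tnth x i : R) * (tnth y i : R).

Definition enorm x : R := Num.sqrt (dot x x).

Definition unit_ball : set (Rn R n) := [set x | enorm x < 1].

Definition peval (P : mpoly n R) x : R :=
  meval (fun i => tnth x i : R) P.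

End euclidean.

Section complex_valued.
Variables (R : realType) (n : nat).
Implicit Types (D : set (Rn R n)) (f : Rn R n -> R[i]).

Definition cabs (z : R[i]) : R := ComplexField.Normc.normc z.

Definition cis (theta : R) : R[i] := Complex (cos theta) (sin theta).

Definition cmeasurable D f : Prop :=
  measurable_fun D (fun x => complex.Re (f x)) /\
  measurable_fun D (fun x => complex.Im (f x)).

Definition cintegrable D f : Prop :=
  (lebesgue_Rn R n).-integrable D (fun x => (complex.Re (f x))%:E) /\
  (lebesgue_Rn R n).-integrable D (fun x => (complex.Im (f x))%:E).

Definition cintegral D f : R[i] :=
  Complex (Rintegral (lebesgue_Rn R n) D (fun x => complex.Re (f x)))
          (Rintegral (lebesgue_Rn R n) D (fun x => complex.Im (f x))).

Definition fourier f (xi : Rn R n) : R[i] :=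
  cintegral setT (fun x => f x * cis (- dot x xi)).

Definition evolution (P : mpoly n R) (t : R) f (x : Rn R n) : R[i] :=
  real_complex R ((2 * pi) ^- n) *
  cintegral setT (fun xi => fourier f xi * cis (dot x xi + peval P xi * t)).

End complex_valued.

Section schwartz.
Variables (R : realType) (n : nat).
Implicit Types (f phi : Rn R n -> R[i]) (x : Rn R n).

(* The point x + h e_i. *)
Definition translate (i : 'I_n) x (h : R) : Rn R n :=
  [tuple (tnth x j : R) + (if j == i then h else 0) | j < n].

Definition has_partial (i : 'I_n) f : Prop := forall x,
  derivable (fun h : R => complex.Re (f (translate i x h))) 0 1 /\
  derivable (fun h : R => complex.Im (f (translate i x h))) 0 1.

Definition partial (i : 'I_n) f x : R[i] :=
  Complex (derive1 (fun h : R => complex.Re (f (translate i x h))) 0)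
          (derive1 (fun h : R => complex.Im (f (translate i x h))) 0).

Definition partials (s : seq 'I_n) f : Rn R n -> R[i] := foldr partial f s.

Definition schwartz_bound (N : nat) (M : R) f : Prop :=
  forall s : seq 'I_n, (size s <= N)%N ->
  forall x, (1 + enorm x) ^+ N * cabs (partials s f x) <= M.

(* No continuity clause is needed: iterated partial derivatives which all exist
   and are all bounded are Lipschitz, so f is C^oo. *)
Definition schwartz f : Prop :=
  (forall (s : seq 'I_n) (i : 'I_n), has_partial i (partials s f)) /\
  (forall N : nat, exists M : R, schwartz_bound N M f).

(* Functionals are total on functions R^n -> C, but only their values on
   Schwartz functions are meaningful. *)
Definition functional := (Rn R n -> R[i]) -> R[i].
Implicit Types u v : functional.

Definition tempered u : Prop :=
  (forall (a : R[i]) phi psi, schwartz phi -> schwartz psi ->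
     u (fun x => a * phi x + psi x) = a * u phi + u psi) /\
  (exists (N : nat) (A : R), forall phi (M : R), schwartz phi ->
     schwartz_bound N M phi -> cabs (u phi) <= A * M).

(* The tempered distribution u is (integration against) the function f. *)
Definition is_function u f : Prop :=
  cmeasurable setT f /\
  forall phi, schwartz phi ->
    cintegrable setT (fun x => f x * phi x) /\
    u phi = cintegral setT (fun x => f x * phi x).

Definition fourier_dist u : functional := fun phi => u (fourier phi).

Definition sobolev_integral (s : R) (F : Rn R n -> R[i]) : \bar R :=
  (\int[lebesgue_Rn R n]_(xi in setT)
     (((1 + enorm xi ^+ 2) `^ s) * cabs (F xi) ^+ 2)%:E)%E.

(* sobolev s u r means that u belongs to H^s(R^n) and that its norm is r. *)
Definition sobolev (s : R) u (r : R) : Prop :=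
  tempered u /\
  exists F : Rn R n -> R[i],
    [/\ is_function (fourier_dist u) F,
        (sobolev_integral s F < +oo)%E &
        r = Num.sqrt ((2 * pi) ^- n * fine (sobolev_integral s F))].

(* v = T_t^P u, i.e. the Fourier transform of v is exp(i t P) times that
   of u. *)
Definition evolution_dist (P : mpoly n R) (t : R) u v : Prop :=
  tempered v /\
  forall phi, schwartz phi ->
    fourier_dist v phi = fourier_dist u (fun xi => cis (peval P xi * t) * phi xi).

Definition supported_in_ball phi : Prop :=
  exists2 r : R, r < 1 & forall x, r < enorm x -> phi x = 0.

Definition is_function_on_ball v (g : Rn R n -> R[i]) : Prop :=
  cmeasurable (@unit_ball R n) g /\
  forall phi, schwartz phi -> supported_in_ball phi ->
    cintegrable (@unit_ball R n) (fun x => g x * phi x) /\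
    v phi = cintegral (@unit_ball R n) (fun x => g x * phi x).

(* g is T_t^P u as a function on the unit ball. In general g is only determined
   almost everywhere; when u is a Schwartz function, it is given at every point
   by the oscillatory integral. *)
Definition evolution_on_ball (P : mpoly n R) (t : R) u
    (g : Rn R n -> R[i]) : Prop :=
  (exists2 v, evolution_dist P t u v & is_function_on_ball v g) /\
  (forall f, schwartz f -> is_function u f ->
     forall x, unit_ball x -> g x = evolution P t f x).

Definition maximal_function (g : R -> Rn R n -> R[i]) x : \bar R :=
  ereal_sup [set (cabs (g t x))%:E | t in [set t : R | 0 < t < 1]].

(* The maximal estimate from H^s to L^1 of the unit ball with constant C. As
   the supremum is over uncountably many t, it is taken for a choice of
   representatives g t of the T_t^P u. *)
Definition maximal_estimate (P : mpoly n R) (s C : R) : Prop :=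
  forall u (r : R), sobolev s u r ->
  exists g : R -> Rn R n -> R[i],
    [/\ forall t : R, 0 < t < 1 -> evolution_on_ball P t u (g t),
        measurable_fun (@unit_ball R n) (maximal_function g) &
        (\int[lebesgue_Rn R n]_(x in @unit_ball R n) maximal_function g x
           <= (C * r)%:E)%E].

End schwartz.

Section polynomials.
Variables (R : realType) (n : nat).
Implicit Types (p : mpoly n R) (A : {set 'I_n}).

Definition is_form (e : nat) p : Prop := p \is ishomog1 e mdeg.

Definition leading_form p : mpoly n R :=
  pihomog mdeg (msize p).-1 p.

Definition monomial_in A (m : multinom n) : Prop :=
  forall i : 'I_n, m i != 0%N -> i \in A.

(* p belongs to the polynomial ring in the variables X_i with i in A. *)
Definition poly_in A p : Prop :=
  forall m : multinom n, m \in msupp p -> monomial_in A m.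

Definition var (i : 'I_n) : mpoly n R := mpolyX R (mnm1 i).

End polynomials.

(* The index of the first variable X_1. *)
Definition first_var (n : nat) (hn : (2 <= n)%N) : 'I_n := Ordinal (ltnW hn).

(* Main.v *)
(* The counterexample is a single wave packet.  Let f^ be a Gaussian centred at
   b = N a, where a is supported off Sigma and off X_1 and q = Q_{k-1}(a) <> 0,
   of width M in the direction xi_1 and of small fixed width kap in the others.
   At the time t = - x_1 / (N^(k-1) q) the term t X_1 Q_{k-1} of the phase cancels
   x_1 xi_1, and all other variations of the phase are of order kap: the terms
   X_1^i Q_{k-i} with 2 <= i < d because Q_{k-i} stays bounded on the packet, and
   those with i >= d because M^d <= kap N^(d-1).  Hence sup_t |T_t f| is bounded
   below on a fixed box, whereas ||f||_{H^s}^2 is at most of order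
   N^(2 max(s, 0)) / M.  Taking M = kap N^((d-1)/d), or M = kap N when the Q_{k-i} with
   i >= d vanish, and letting N go to infinity gives the two bounds. *)
Require Import Defs.
From HB Require Import structures.
From mathcomp Require Import all_boot all_order all_algebra.
From mathcomp Require Import -(notations) mpoly.
From mathcomp Require Import all_classical all_reals all_analysis.
From mathcomp Require Import measurable_realfun complex.
From mathcomp Require Import ring lra zify.

Set Implicit Arguments.
Unset Strict Implicit.
Unset Printing Implicit Defensive.

Import Order.TTheory GRing.Theory Num.Theory.
Import numFieldNormedType.Exports.

Local Open Scope classical_set_scope.
Local Open Scope ring_scope.

(** A Gaussian packet is chosen because both f and its Fourier transform are explicit. The price is
    the tails: the phase is not uniformly close to its value at b, and its error grows polynomially
    in the normalised distance to b. That growth is bounded by a constant times exp(S/4), S being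
    the sum of the squared normalised displacements; its square exp(S/2) uses up half of the
    Gaussian exp(-S). The scales are written N = L^p and M = kap L^p' with integers p' <= p, so that
    M is of order N^(p'/p) without fractional powers. Both claims then take the form s >= p'/(2p),
    with (p, p') = (d, d-1) or (1, 1). The constants are fixed in a strict order: the phase constant
    A depends neither on kap nor on L; kap is then taken small in terms of A and n; only afterwards
    does L tend to infinity. A negative s would make the Sobolev weight small, but bounding it by 1
    costs nothing: p'/(2p) is positive, so s < p'/(2p) implies max(s, 0) < p'/(2p). The box lies on
    one side of x_1 = 0, chosen by the sign of q, so that the time t is positive; it is below 1 once
    N^(k-1) |q| >= 1. *)

Section integration_Rn.
Variable R : realType.
Local Notation mu := (@lebesgue_measure R).
Local Notation Rn n := (Rn R n).

(** * Iterated integration over R^n and the Gaussian integral *)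

Definition consR n (p : measurableTypeR R * Rn n) : Rn n.+1 :=
  [the n.+1.-tuple (measurableTypeR R) of p.1 :: p.2].

Lemma measurable_consR n : measurable_fun [set: _] (@consR n).
Proof. by apply: measurable_cons. Qed.

Lemma tnth_consR0 n p : tnth (@consR n p) ord0 = p.1.
Proof. by []. Qed.

Lemma tnth_consRS n p (j : 'I_n) : tnth (@consR n p) (lift ord0 j) = tnth p.2 j.
Proof. by rewrite (tnth_nth p.1) (tnth_nth p.1). Qed.

Lemma ge0_integral_RnS n (f : Rn n.+1 -> \bar R) :
  measurable_fun setT f -> (forall x, 0 <= f x)%E ->
  (\int[lebesgue_Rn R n.+1]_x f x =
   \int[mu]_a \int[lebesgue_Rn R n]_x f (consR (a, x)))%E.
Proof.
move=> mf f0.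
rewrite [LHS](ge0_integral_pushforward (measurable_consR (n := n)))//.
rewrite fubini_tonelli1//.
- by apply: measurableT_comp => //; exact: measurable_consR.
- by move=> x; exact: f0.
Qed.

Lemma integrable_RnS n (f : Rn n.+1 -> \bar R) :
  (lebesgue_Rn R n.+1).-integrable setT f ->
  (mu \x lebesgue_Rn R n)%E.-integrable setT (f \o @consR n).
Proof.
move=> /integrableP[mf fi]; apply/integrableP; split.
  by apply: measurableT_comp => //; exact: measurable_consR.
rewrite -(ge0_integral_pushforward (measurable_consR (n := n))
  (mu \x lebesgue_Rn R n)%E measurableT (f := fun x => `|f x|%E))//.
- exact: measurableT_comp.
Qed.

Lemma integral_RnS n (f : Rn n.+1 -> \bar R) :
  (lebesgue_Rn R n.+1).-integrable setT f ->
  (\int[lebesgue_Rn R n.+1]_x f x =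
   \int[mu]_a \int[lebesgue_Rn R n]_x f (consR (a, x)))%E.
Proof.
move=> fi.
rewrite [LHS](integral_pushforward (measurable_consR (n := n)))//.
- by rewrite -integral12_prod_meas1//; exact: integrable_RnS.
- exact: measurable_int fi.
- exact: integrable_RnS.
Qed.

Lemma integral_Rn0 (f : Rn 0 -> R) :
  (\int[lebesgue_Rn R 0]_x (f x)%:E = (f [tuple])%:E)%E.
Proof.
rewrite (_ : (fun x => _) = cst (f [tuple])%:E); last first.
  by apply/funext => x; rewrite [x]tuple0.
by rewrite integral_dirac// diracT mul1e.
Qed.

Lemma measurable_prod_tnth n (h : 'I_n -> R -> R) :
  (forall j, measurable_fun setT (h j)) ->
  measurable_fun setT (fun x : Rn n => \prod_(j < n) h j (tnth x j)).
Proof.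
move=> mh; apply: measurable_prod => j _.
by apply: (measurableT_comp (mh j)); exact: measurable_tnth.
Qed.

Lemma integral_prod n (h : 'I_n -> R -> R) (c : 'I_n -> R) :
  (forall j, measurable_fun setT (h j)) -> (forall j x, 0 <= h j x) ->
  (forall j, \int[mu]_x (h j x)%:E = (c j)%:E)%E ->
  (\int[lebesgue_Rn R n]_x (\prod_(j < n) h j (tnth x j))%:E =
   (\prod_(j < n) c j)%:E)%E.
Proof.
elim: n h c => [|n IH] h c mh h0 hc.
  by rewrite (integral_Rn0 (fun x => _)) !big_ord0.
have c0 j : 0 <= c j.
  by rewrite -lee_fin -hc; apply: integral_ge0 => x _; rewrite lee_fin.
rewrite ge0_integral_RnS; last 2 first.
- by apply/measurable_EFinP; exact: measurable_prod_tnth.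
- by move=> x; rewrite lee_fin; apply: prodr_ge0.
transitivity
  (\int[mu]_a ((\prod_(j < n) c (lift ord0 j))%:E * (h ord0 a)%:E))%E.
  apply: eq_integral => a _.
  under eq_integral.
    move=> x _; rewrite big_ord_recl tnth_consR0/=.
    under eq_bigr do rewrite tnth_consRS/=.
    rewrite EFinM.
    over.
  rewrite ge0_integralZl_EFin//.
  - rewrite (IH (fun j => h (lift ord0 j)) (fun j => c (lift ord0 j)))//.
    by rewrite -EFinM mulrC EFinM.
  - by move=> x _; rewrite lee_fin; apply: prodr_ge0.
  - apply/measurable_EFinP.
    by apply: (measurable_prod_tnth (h := fun j => h (lift ord0 j))).
rewrite ge0_integralZl_EFin//.
- by rewrite hc -EFinM big_ord_recl mulrC.
- by move=> x _; rewrite lee_fin.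
- by apply/measurable_EFinP; exact: (mh ord0).
- by apply: prodr_ge0.
Qed.

Definition gauss (b l x : R) : R := expR (- ((x - b) / l) ^+ 2).

Lemma measurable_gauss b l : measurable_fun setT (gauss b l).
Proof.
apply: measurableT_comp => //; apply: measurableT_comp => //.
apply: measurable_funX => //; apply: measurable_funM => //.
exact: measurable_funB.
Qed.

Lemma integral_gauss b l : 0 < l ->
  (\int[mu]_x (gauss b l x)%:E = (Num.sqrt pi * l)%:E)%E.
Proof.
(* The normal density of standard deviation [s] has exponent -(x - b)^2 / (2 s^2), which is that of
   [gauss b l] when s = l / sqrt 2. *)
move=> l0; pose s := l / Num.sqrt 2.
have s0 : s != 0 by rewrite mulf_neq0 ?invr_eq0 ?gt_eqF ?sqrtr_gt0.
have := integral_normal_pdf b s.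
rewrite normal_pdfE//.
have E x : gauss b l x = normal_fun b s x.
  rewrite /gauss /normal_fun /s; congr expR.
  rewrite !expr_div_n sqr_sqrtr//; field; lra.
under eq_integral do rewrite -E EFinM.
rewrite ge0_integralZl_EFin ?normal_peak_ge0//; last first.
- by apply/measurable_EFinP; exact: (measurable_gauss b l).
- by move=> x _; rewrite lee_fin expR_ge0.
have -> : normal_peak s = (Num.sqrt pi * l)^-1.
  rewrite /normal_peak /s; congr (_^-1).
  rewrite expr_div_n sqr_sqrtr//.
  have -> : l ^+ 2 / 2 * pi *+ 2 = l ^+ 2 * pi by lra.
  by rewrite sqrtrM ?sqr_ge0// sqrtr_sqr gtr0_norm// mulrC.
have g0 : 0 < Num.sqrt pi * l by rewrite mulr_gt0// sqrtr_gt0 pi_gt0.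
move=> /(congr1 (fun y => (Num.sqrt pi * l)%:E * y))%E.
by rewrite muleA -EFinM mulfV ?gt_eqF// mul1e mule1.
Qed.

End integration_Rn.

(** * Modulus and unimodular exponentials *)

Section complex_numbers.
Variable R : realType.
Implicit Types (z w : R[i]) (a b : R).

Lemma complexReM z w :
  complex.Re (z * w) = complex.Re z * complex.Re w - complex.Im z * complex.Im w.
Proof. by case: z w => [a b] [c e]. Qed.

Lemma complexImM z w :
  complex.Im (z * w) = complex.Re z * complex.Im w + complex.Im z * complex.Re w.
Proof. by case: z w => [a b] [c e]. Qed.

Lemma complexReD z w : complex.Re (z + w) = complex.Re z + complex.Re w.
Proof. by case: z w => [a b] [c e]. Qed.

Lemma complexImD z w : complex.Im (z + w) = complex.Im z + complex.Im w.
Proof. by case: z w => [a b] [c e]. Qed.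

Lemma complex_ext z w :
  complex.Re z = complex.Re w -> complex.Im z = complex.Im w -> z = w.
Proof. by case: z w => [a b] [c e] /= -> ->. Qed.

Lemma cabsE z : cabs z = Num.sqrt (complex.Re z ^+ 2 + complex.Im z ^+ 2).
Proof. by case: z. Qed.

Lemma cabsM z w : cabs (z * w) = cabs z * cabs w.
Proof. exact: ComplexField.Normc.normcM. Qed.

Lemma cabs_ge0 z : 0 <= cabs z.
Proof. by rewrite cabsE sqrtr_ge0. Qed.

Lemma sqr_cabs z : cabs z ^+ 2 = complex.Re z ^+ 2 + complex.Im z ^+ 2.
Proof. by rewrite cabsE sqr_sqrtr// addr_ge0 ?sqr_ge0. Qed.

Lemma cabs_ge_Re z : `|complex.Re z| <= cabs z.
Proof. by rewrite cabsE -sqrtr_sqr ler_wsqrtr// lerDl sqr_ge0. Qed.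

Lemma cabs_ge_Im z : `|complex.Im z| <= cabs z.
Proof. by rewrite cabsE -sqrtr_sqr ler_wsqrtr// lerDr sqr_ge0. Qed.

Lemma cabs_le_Re_Im z : cabs z <= `|complex.Re z| + `|complex.Im z|.
Proof.
rewrite -ler_sqr ?nnegrE ?cabs_ge0 ?addr_ge0// sqr_cabs sqrrD !real_normK ?num_real//.
by rewrite lerD2r lerDl mulrn_wge0// mulr_ge0.
Qed.

Lemma ler_cabsD z w : cabs (z + w) <= cabs z + cabs w.
Proof.
exact: (@le_normcD R).
Qed.

Lemma cabs_cis a : cabs (cis a) = 1.
Proof. by rewrite cabsE /cis/= cos2Dsin2 sqrtr1. Qed.

Lemma cisD a b : cis (a + b) = cis a * cis b.
Proof.
by apply: complex_ext; rewrite ?complexReM ?complexImM /cis/= ?cosD ?sinD; lra.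
Qed.

Lemma cis0 : cis 0 = 1 :> R[i].
Proof. by apply: complex_ext; rewrite /cis/= ?cos0 ?sin0. Qed.

Lemma cabs_real a : cabs (real_complex R a) = `|a|.
Proof. by rewrite cabsE/= expr0n addr0 sqrtr_sqr. Qed.

End complex_numbers.

(** * Integrals of complex-valued functions, taken componentwise *)

Section complex_integrals.
Variables (R : realType) (n : nat).
Local Notation mu := (lebesgue_Rn R n).
Implicit Types (f g : Rn R n -> R[i]) (h : Rn R n -> R).

Lemma measurable_dot (x : Rn R n) : measurable_fun setT (fun y => dot x y).
Proof.
apply: measurable_sum => j; apply: measurable_funM; first exact: measurable_cst.
exact: measurable_tnth.
Qed.

Lemma dotC (x y : Rn R n) : dot x y = dot y x.
Proof. by apply: eq_bigr => j _; rewrite mulrC. Qed.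

Lemma measurable_enorm : measurable_fun setT (@enorm R n).
Proof.
apply: (@measurableT_comp _ _ _ _ _ _ (@Num.sqrt R) _ (fun x : Rn R n => dot x x)).
  apply: continuous_measurable_fun; exact: sqrt_continuous.
apply: measurable_sum => j; apply: measurable_funM; exact: measurable_tnth.
Qed.

Lemma measurable_unit_ball : measurable (@unit_ball R n).
Proof.
have -> : @unit_ball R n = (@enorm R n) @^-1` `]-oo, 1[%classic.
  by apply/seteqP; split => x /=; rewrite /unit_ball/= in_itv.
rewrite -[X in measurable X]setTI; exact: measurable_enorm.
Qed.

Lemma cmeasurableM f g : cmeasurable setT f -> cmeasurable setT g ->
  cmeasurable setT (fun x => f x * g x).
Proof.
move=> [rf jf] [rg jg]; split.
- under eq_fun do rewrite complexReM.
  by apply: measurable_funB; apply: measurable_funM.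
- under eq_fun do rewrite complexImM.
  by apply: measurable_funD; apply: measurable_funM.
Qed.

Lemma cmeasurable_cis h : measurable_fun setT h ->
  cmeasurable setT (fun x => cis (h x)).
Proof.
move=> mh; split => /=.
- apply: measurableT_comp => //; exact: (continuous_measurable_fun (@continuous_cos R)).
- apply: measurableT_comp => //; exact: (continuous_measurable_fun (@continuous_sin R)).
Qed.

Lemma measurable_cabs f : cmeasurable setT f ->
  measurable_fun setT (fun x => cabs (f x)).
Proof.
move=> [rf jf].
under eq_fun do rewrite cabsE.
apply: (@measurableT_comp _ _ _ _ _ _ (@Num.sqrt R)).
  apply: continuous_measurable_fun; exact: sqrt_continuous.
by apply: measurable_funD; apply: measurable_funX.
Qed.

Lemma cintegrable_le f h : cmeasurable setT f ->
  mu.-integrable setT (EFin \o h) -> (forall x, cabs (f x) <= h x) ->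
  cintegrable setT f.
Proof.
move=> [rf jf] ih fh; split.
- apply: (le_integrable _ _ _ ih) => //; first exact/measurable_EFinP.
  move=> x _ /=; rewrite lee_fin (le_trans (cabs_ge_Re _))//.
  by rewrite (le_trans (fh x))// ler_norm.
- apply: (le_integrable _ _ _ ih) => //; first exact/measurable_EFinP.
  move=> x _ /=; rewrite lee_fin (le_trans (cabs_ge_Im _))//.
  by rewrite (le_trans (fh x))// ler_norm.
Qed.

Lemma cintegrableZ (a : R[i]) f : cintegrable setT f ->
  cintegrable setT (fun x => a * f x).
Proof.
move=> [rf jf]; split.
- under eq_fun do rewrite complexReM EFinB !EFinM.
  by apply: (integrableB measurableT); apply: (integrableZl measurableT).
- under eq_fun do rewrite complexImM EFinD !EFinM.
  by apply: (integrableD measurableT); apply: (integrableZl measurableT).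
Qed.

Lemma cintegralZ (a : R[i]) f : cintegrable setT f ->
  cintegral setT (fun x => a * f x) = a * cintegral setT f.
Proof.
move=> [rf jf]; apply: complex_ext; rewrite ?complexReM ?complexImM /cintegral/=.
- under eq_Rintegral do rewrite complexReM.
  rewrite RintegralB// ?RintegralZl//.
  + exact: (integrableZl measurableT _ rf).
  + exact: (integrableZl measurableT _ jf).
- under eq_Rintegral do rewrite complexImM.
  rewrite RintegralD// ?RintegralZl//.
  + exact: (integrableZl measurableT _ jf).
  + exact: (integrableZl measurableT _ rf).
Qed.

Lemma cintegralD f g : cintegrable setT f -> cintegrable setT g ->
  cintegral setT (fun x => f x + g x) = cintegral setT f + cintegral setT g.
Proof.
move=> [rf jf] [rg jg]; apply: complex_ext; rewrite ?complexReD ?complexImD /cintegral/=.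
- by under eq_Rintegral do rewrite complexReD; rewrite RintegralD.
- by under eq_Rintegral do rewrite complexImD; rewrite RintegralD.
Qed.

(** The factor 2 comes from estimating the real and imaginary parts separately. The bound serves to
    prove temperedness, where any finite constant will do. *)
Lemma cabs_cintegral_le f h : cintegrable setT f ->
  mu.-integrable setT (EFin \o h) -> (forall x, cabs (f x) <= h x) ->
  cabs (cintegral setT f) <= 2 * Rintegral mu setT h.
Proof.
move=> [rf jf] ih fh; apply: (le_trans (cabs_le_Re_Im _)).
rewrite mulr_natl mulr2n; apply: lerD => /=.
- apply: (le_trans (le_normr_Rintegral _ rf)) => //.
  apply: le_Rintegral => //; first exact: integrable_norm.
  by move=> x _; exact: le_trans (cabs_ge_Re _) (fh x).
- apply: (le_trans (le_normr_Rintegral _ jf)) => //.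
  apply: le_Rintegral => //; first exact: integrable_norm.
  by move=> x _; exact: le_trans (cabs_ge_Im _) (fh x).
Qed.

(** Domination by the product [h x * g y] makes every inner integral finite, not merely almost every
    one. So [fine] can be moved out of both iterated integrals, and Fubini applies to the
    extended-real ones. *)
Lemma Rintegral_swap (K : Rn R n * Rn R n -> R) (h g : Rn R n -> R) :
  measurable_fun setT K ->
  mu.-integrable setT (EFin \o h) -> mu.-integrable setT (EFin \o g) ->
  (forall x, 0 <= h x) -> (forall x, 0 <= g x) ->
  (forall x y, `|K (x, y)| <= h x * g y) ->
  Rintegral mu setT (fun x => Rintegral mu setT (fun y => K (x, y))) =
  Rintegral mu setT (fun y => Rintegral mu setT (fun x => K (x, y))).
Proof.
move=> mK ih ig h0 g0 Khg.
have fx x : (\int[mu]_y (K (x, y))%:E)%E \is a fin_num.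
  apply: integrable_fin_num => //.
  apply: (le_integrable _ _ _ (integrableZl measurableT (h x) ig)) => //.
    by apply/measurable_EFinP; exact: measurableT_comp.
  by move=> y _ /=; rewrite lee_fin (le_trans (Khg x y))// ler_norm.
have fy y : (\int[mu]_x (K (x, y))%:E)%E \is a fin_num.
  apply: integrable_fin_num => //.
  apply: (le_integrable _ _ _ (integrableZl measurableT (g y) ih)) => //.
    by apply/measurable_EFinP; exact: measurableT_comp.
  by move=> x _ /=; rewrite lee_fin (le_trans (Khg x y))// mulrC ler_norm.
rewrite /Rintegral; congr fine.
under eq_integral do rewrite fineK//.
under [RHS]eq_integral do rewrite fineK//.
apply: (Fubini (f := EFin \o K)).
apply/integrable12ltyP; first exact/measurable_EFinP.
have gfin : (\int[mu]_y (g y)%:E)%E \is a fin_num by exact: integrable_fin_num.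
apply: (@le_lt_trans _ _ (\int[mu]_x ((h x)%:E * \int[mu]_y (g y)%:E))%E).
  apply: ge0_le_integral => //.
  - by move=> x _; apply: integral_ge0.
  - apply: (measurable_fun_fubini_tonelli_F (fun z => `|(K z)%:E|%E)) => //.
    by apply: measurableT_comp => //; exact/measurable_EFinP.
  - by apply: emeasurable_funM => //; exact: (measurable_int _ ih).
  move=> x _; rewrite -ge0_integralZl_EFin//.
  - apply: ge0_le_integral => //.
    + by apply: measurableT_comp => //; apply/measurable_EFinP; exact: measurableT_comp.
    + by apply: emeasurable_funM => //; exact: (measurable_int _ ig).
    by move=> y _; rewrite lee_fin.
  - by move=> y _; rewrite lee_fin.
  - exact: (measurable_int _ ig).
rewrite -(fineK gfin) -[ltLHS]/(\int[mu]_x ((EFin \o h) x * _))%E integralZr//.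
rewrite ltey_eq fin_numM//; exact: integrable_fin_num.
Qed.

Lemma cintegral_swap (K : Rn R n * Rn R n -> R[i]) (h g : Rn R n -> R) :
  measurable_fun setT (fun z => complex.Re (K z)) ->
  measurable_fun setT (fun z => complex.Im (K z)) ->
  mu.-integrable setT (EFin \o h) -> mu.-integrable setT (EFin \o g) ->
  (forall x, 0 <= h x) -> (forall x, 0 <= g x) ->
  (forall x y, cabs (K (x, y)) <= h x * g y) ->
  cintegral setT (fun x => cintegral setT (fun y => K (x, y))) =
  cintegral setT (fun y => cintegral setT (fun x => K (x, y))).
Proof.
move=> mr mj ih ig h0 g0 Khg; rewrite /cintegral/=; congr Complex.
- apply: (Rintegral_swap mr ih ig) => // x y.
  exact: le_trans (cabs_ge_Re _) (Khg x y).
- apply: (Rintegral_swap mj ih ig) => // x y.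
  exact: le_trans (cabs_ge_Im _) (Khg x y).
Qed.

End complex_integrals.

(** * Measurability and integrability of Schwartz functions *)

Section schwartz_functions.
Variable R : realType.

Lemma floor_invS_cvg (a : R) :
  (Num.floor (k.+1%:R * a))%:~R / k.+1%:R @[k --> \oo] --> a.
Proof.
apply/cvgrPdist_lt => e e0.
have := @near_infty_natSinv_lt R (PosNum e0); apply: filterS => k /= ke.
have k0 : 0 < k.+1%:R :> R by [].
have /andP[h1 h2] := mem_rg1_floor (k.+1%:R * a).
set F := (Num.floor _)%:~R in h1 h2 *.
have -> : a - F / k.+1%:R = (k.+1%:R * a - F) / k.+1%:R.
  by rewrite mulrBl [k.+1%:R * a]mulrC mulfK// gt_eqF.
rewrite ger0_norm ?divr_ge0 ?subr_ge0//; apply: le_lt_trans ke.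
by rewrite ler_pdivrMr// mulVf ?gt_eqF// lerBlDl ltW.
Qed.

(** Lebesgue's argument: round the first coordinate down to a grid, so that the function becomes a
    countable gluing of functions of the remaining coordinates, measurable by induction; then refine
    the grid. It is stated for separate continuity because the definition of [schwartz] only
    provides derivatives along the axes. *)
Lemma measurable_separately_continuous n (g : Rn R n -> R) :
  (forall i x, g (translate i x h) @[h --> (0 : R)] --> g x) ->
  measurable_fun setT g.
Proof.
elim: n g => [|n IH] g cg.
  rewrite (_ : g = cst (g [tuple])); first exact: measurable_cst.
  by apply/funext => x; rewrite [x]tuple0.
pose r (k : nat) (a : R) : R := (Num.floor (k.+1%:R * a))%:~R / k.+1%:R.
pose tl (x : Rn R n.+1) : Rn R n := [tuple of behead x].
pose G k (x : Rn R n.+1) := g (consR (r k (tnth x ord0), tl x)).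
have mg a : measurable_fun setT (fun y => g (consR (a, y))).
  apply: IH => i x.
  have E h : translate (lift ord0 i) (consR (a, x)) h = consR (a, translate i x h).
    apply: eq_from_tnth => j; rewrite tnth_mktuple.
    case: (unliftP ord0 j) => [j'|] ->.
      by rewrite !tnth_consRS tnth_mktuple (inj_eq lift_inj).
    by rewrite !tnth_consR0/= addr0.
  by have := cg (lift ord0 i) (consR (a, x)); under eq_fun do rewrite E; exact.
have mG k : measurable_fun setT (G k).
  move=> _ B mB; rewrite setTI.
  pose E (q : int) : set (Rn R n.+1) :=
    [set x | Num.floor (k.+1%:R * (tnth x ord0 : R)) = q] `&`
    [set x | B (g (consR (q%:~R / k.+1%:R, tl x)))].
  (* The floor takes countably many values, and on each of its level sets the first coordinate of
     the argument of [g] is frozen, so [mg] applies. *)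
  have -> : G k @^-1` B = \bigcup_q E q.
    apply/seteqP; split => x.
      by move=> Bx; exists (Num.floor (k.+1%:R * (tnth x ord0 : R))).
    by move=> [q _ [/= <-]].
  apply: countable_bigcupT_measurable => // q; apply: measurableI.
    rewrite (_ : [set x | _] = (fun x : Rn R n.+1 => tnth x ord0) @^-1`
      `[q%:~R / k.+1%:R, (q + 1)%:~R / k.+1%:R[%classic).
      rewrite -[X in measurable X]setTI; exact: measurable_tnth.
    apply/seteqP; split => x /=; rewrite in_itv/= ler_pdivrMr// ltr_pdivlMr//
      mulrC -floor_eq; last by move/eqP.
    by move=> ->.
  rewrite (_ : [set x | _] = tl @^-1`
    ((fun y => g (consR (q%:~R / k.+1%:R, y))) @^-1` B))//.
  rewrite -[X in measurable X]setTI; apply: measurable_behead => //.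
  by rewrite -[X in measurable X]setTI; exact: mg.
apply: (measurable_fun_cvg mG) => x _.
have eqx a : consR (a, tl x) = translate ord0 x (a - tnth x ord0).
  apply: eq_from_tnth => j; rewrite tnth_mktuple.
  case: (unliftP ord0 j) => [j'|] ->.
    by rewrite tnth_consRS addr0 (tnth_nth 0) [RHS](tnth_nth 0) /= nth_behead.
  by rewrite tnth_consR0 eqxx addrC subrK.
rewrite /G.
under eq_fun do rewrite eqx.
apply: (cvg_comp (fun k => r k (tnth x ord0) - tnth x ord0) _ _ (cg ord0 x)).
rewrite -(subrr (tnth x ord0 : R)); apply: cvgB; last exact: cvg_cst.
exact: floor_invS_cvg.
Qed.

Lemma derivable_cvg (h : R -> R) : derivable h 0 1 -> h x @[x --> (0 : R)] --> h 0.
Proof.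
by move=> /derivable1_diffP/differentiable_continuous.
Qed.

Lemma translate0 n (i : 'I_n) (x : Rn R n) : translate i x 0 = x.
Proof.
by apply: eq_from_tnth => j; rewrite tnth_mktuple; case: ifP; rewrite addr0.
Qed.

Lemma schwartz_cmeasurable n (phi : Rn R n -> R[i]) : schwartz phi -> cmeasurable setT phi.
Proof.
move=> [+ _] => /(_ [::]) /= dphi; split; apply: measurable_separately_continuous => i x.
- by have [/derivable_cvg + _] := dphi i x; rewrite translate0.
- by have [_ /derivable_cvg +] := dphi i x; rewrite translate0.
Qed.

Lemma tnth_le_enorm n (x : Rn R n) j : `|tnth x j : R| <= enorm x.
Proof.
rewrite /enorm -sqrtr_sqr ler_wsqrtr// /dot (bigD1 j)//= expr2 lerDl sumr_ge0// => i _.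
by rewrite -expr2 sqr_ge0.
Qed.

Lemma enorm_ge0 n (x : Rn R n) : 0 <= enorm x.
Proof. exact: sqrtr_ge0. Qed.

Lemma integral_oneDsqrV :
  (\int[@lebesgue_measure R]_x ((oneDsqr x)^-1)%:E = pi%:E)%E.
Proof.
rewrite ge0_symfun_integralT.
- rewrite -set_itvcy integral0y_oneDsqr -EFinM; congr EFin.
  by rewrite mulrC divfK.
- by move=> x; rewrite invr_ge0 (le_trans ler01)// oneDsqr_ge1.
- exact: continuous_oneDsqrV.
- by move=> x; rewrite /oneDsqr/= sqrrN.
Qed.

(** A product weight in place of a power of 1 + |x|: its integral factorises into one-dimensional
    Cauchy integrals, each equal to pi. *)
Definition japanese n (x : Rn R n) : R := \prod_(j < n) (oneDsqr (tnth x j : R))^-1.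

Lemma integrable_japanese n : (lebesgue_Rn R n).-integrable setT (EFin \o @japanese n).
Proof.
have mo : measurable_fun setT (fun x : R => (oneDsqr x)^-1).
  exact: (continuous_measurable_fun (@continuous_oneDsqrV R)).
have o0 (x : R) : 0 <= (oneDsqr x)^-1.
  by rewrite invr_ge0 (le_trans ler01)// oneDsqr_ge1.
apply/integrableP; split.
  by apply/measurable_EFinP; apply: (measurable_prod_tnth (h := fun=> fun x : R => (oneDsqr x)^-1)).
under eq_integral.
  move=> x _; rewrite /= ger0_norm ?prodr_ge0//; over.
rewrite (integral_prod (h := fun=> fun x : R => (oneDsqr x)^-1) (c := fun=> pi)) ?ltry// => _.
exact: integral_oneDsqrV.
Qed.

(** Each of the n factors satisfies 1 + x_j^2 <= (1 + |x|)^2, hence the exponent 2n. A Schwartz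
    bound of that order then dominates by [japanese]. *)
Lemma japanese_ge n (x : Rn R n) : 1 <= (1 + enorm x) ^+ (2 * n) * japanese x.
Proof.
rewrite /japanese exprM -[n in _ ^+ n]card_ord -prodr_const -big_split/=.
elim/big_rec: _ => // j y _ y1; rewrite -[leLHS]mulr1 ler_pM//.
rewrite ler_pdivlMr; last by rewrite (lt_le_trans ltr01)// oneDsqr_ge1.
rewrite mul1r /oneDsqr.
have h := tnth_le_enorm x j.
have : (tnth x j : R) ^+ 2 <= enorm x ^+ 2.
  by rewrite -real_normK ?num_real// lerXn2r ?nnegrE ?enorm_ge0.
have := enorm_ge0 x; nra.
Qed.

Lemma japanese_ge0 n (x : Rn R n) : 0 <= japanese x.
Proof.
by apply: prodr_ge0 => j _; rewrite invr_ge0 (le_trans ler01)// oneDsqr_ge1.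
Qed.

Lemma schwartz_integrable n (phi : Rn R n -> R[i]) : schwartz phi ->
  (lebesgue_Rn R n).-integrable setT (EFin \o (fun x => cabs (phi x))).
Proof.
move=> sphi; have [_ /(_ (2 * n)%N)[M Mb]] := sphi.
apply: (le_integrable _ _ _
  (integrableZl measurableT M (integrable_japanese n))) => //.
  by apply/measurable_EFinP; apply: measurable_cabs; exact: schwartz_cmeasurable.
move=> x _; rewrite /= lee_fin ger0_norm ?cabs_ge0//.
have {}Mb := Mb [::] isT x.
rewrite (le_trans _ (ler_norm _))//.
apply: (@le_trans _ _ ((1 + enorm x) ^+ (2 * n) * cabs (phi x) * japanese x)).
  by rewrite mulrAC ler_peMl ?cabs_ge0// japanese_ge.
by rewrite ler_wpM2r// japanese_ge0.
Qed.

Lemma schwartz_bounded n N (phi : Rn R n -> R[i]) M : schwartz_bound N M phi ->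
  forall x, cabs (phi x) <= M.
Proof.
move=> /(_ [::] isT) + x => /(_ x) /=; apply: le_trans.
by rewrite ler_peMl ?cabs_ge0// exprn_ege1// lerDl enorm_ge0.
Qed.

End schwartz_functions.

(** * The cosine transform of a one-dimensional Gaussian *)

Section gaussian_fourier_transform.
Variable R : realType.
Local Notation mu := (@lebesgue_measure R).

Lemma is_derive1M (f g : R -> R) (x df dg : R) :
  is_derive x 1 f df -> is_derive x 1 g dg ->
  is_derive x 1 (fun t => f t * g t) (df * g x + f x * dg).
Proof.
move=> hf hg; apply: (is_derive_eq (is_deriveM hf hg)).
by rewrite /GRing.scale/= addrC mulrC.
Qed.

Lemma is_derive1Zl (f : R -> R) (x a df : R) :
  is_derive x 1 f df -> is_derive x 1 (fun t => a * f t) (a * df).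
Proof. by move=> hf; exact: is_deriveZ. Qed.

Lemma is_derive1D (f g : R -> R) (x df dg : R) :
  is_derive x 1 f df -> is_derive x 1 g dg ->
  is_derive x 1 (fun t => f t + g t) (df + dg).
Proof. by move=> hf hg; exact: is_deriveD. Qed.

Lemma is_derive1_chain (f g : R -> R) (x df dg : R) :
  is_derive (g x) 1 f df -> is_derive x 1 g dg ->
  is_derive x 1 (fun t => f (g t)) (df * dg).
Proof. by move=> hf hg; exact: (is_derive1_comp (f := f) (g := g)). Qed.

Lemma is_derive1_affine (a c x : R) : is_derive x 1 (fun t => a * t + c) a.
Proof.
have h1 : is_derive x 1 (fun t : R => a * t) (a * 1).
  by apply: is_derive1Zl; exact: is_derive_id.
rewrite -[X in is_derive _ _ _ X]addr0 -[X in is_derive _ _ _ (X + _)]mulr1.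
by apply: is_derive1D; exact: is_derive_cst.
Qed.

Lemma is_derive_derive1 (f : R -> R) (x df : R) : is_derive x 1 f df -> derive1 f x = df.
Proof. by move=> h; rewrite derive1E; exact: derive_val. Qed.

Lemma is_derive_continuous (f : R -> R) (x df : R) : is_derive x 1 f df ->
  {for x, continuous f}.
Proof.
by case=> /derivable1_diffP/differentiable_continuous.
Qed.

(** The fundamental theorem of calculus on [-(n+1), n+1], then dominated convergence with the
    integrable [g] itself as majorant. *)
Lemma Rintegral_derive_eq0 (G g : R -> R) :
  (forall x : R, is_derive x 1 G (g x)) -> continuous g ->
  mu.-integrable setT (EFin \o g) ->
  G n.+1%:R @[n --> \oo] --> 0 -> G (- n.+1%:R) @[n --> \oo] --> 0 ->
  Rintegral mu setT g = 0.
Proof.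
move=> dG cg ig Gy GNy.
pose I n : set R := `[- n.+1%:R, n.+1%:R]%classic.
pose f n := (EFin \o g) \_ (I n).
have mg : measurable_fun setT (EFin \o g) by exact: measurable_int ig.
have fE n : (\int[mu]_x f n x = (G n.+1%:R - G (- n.+1%:R))%:E)%E.
  rewrite /f -integral_mkcond (continuous_FTC2 (F := G)) ?EFinB//.
  - by rewrite gtrN.
  - by apply: continuous_subspaceT.
  - split => //.
    + apply: cvg_at_right_filter; exact: (is_derive_continuous (dG (- n.+1%:R))).
    + apply: cvg_at_left_filter; exact: (is_derive_continuous (dG n.+1%:R)).
  - by move=> x _; apply: is_derive_derive1.
have cf : (\int[mu]_x f n x)%E @[n --> \oo] --> (\int[mu]_x (g x)%:E)%E.
  apply: (@dominated_cvg _ _ _ mu _ measurableT f (EFin \o g) (fun x => `|(g x)%:E|%E)) => //.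
  - move=> n; apply/(measurable_restrictT (EFin \o g)); first exact: measurable_itv.
    by apply: (measurable_funS measurableT); last exact: mg.
  - move=> x _; apply: cvg_near_cst.
    near=> n; rewrite /f patchE ifT// inE /I/= in_itv/= -ler_norml.
    apply: (@le_trans _ _ n%:R); last by rewrite ler_nat.
    by near: n; exact: nbhs_infty_ger.
  - exact: integrable_abse.
  - by move=> n x _; rewrite /f patchE; case: ifP => // _; rewrite [X in abse X]/= abse0 abse_ge0.
have cf0 : (\int[mu]_x f n x)%E @[n --> \oo] --> (0 : R)%:E.
  under eq_fun do rewrite fE.
  apply: cvg_EFin; first exact: nearW.
  by rewrite -(subr0 0); apply: cvgB.
by rewrite /Rintegral (cvg_unique (@ereal_hausdorff R) cf cf0).
Unshelve. all: end_near. Qed.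

Lemma gauss_ge0 b w (x : R) : 0 <= gauss b w x.
Proof. exact: expR_ge0. Qed.

(** With y = |x| / w, the ratio of the two Gaussians is exp(-3 y^2 / 4), and 1 + y <= 2 (1 + 3 y^2 /
    4) <= 2 exp(3 y^2 / 4). A linear factor is thus traded for a doubled width; iterating this gives
    decay of every order. *)
Lemma gauss_le_wider (w x : R) : 0 < w ->
  (1 + `|x| / w) * gauss 0 w x <= 2 * gauss 0 (2 * w) x.
Proof.
move=> w0; rewrite /gauss subr0.
have -> : - (x / w) ^+ 2 = - (x / (2 * w)) ^+ 2 - 3 / 4 * (x / w) ^+ 2 by field; lra.
rewrite expRD mulrCA mulrC ler_wpM2r ?expR_ge0//.
have y0 : 0 <= `|x| / w by rewrite divr_ge0// ltW.
have -> : (x / w) ^+ 2 = (`|x| / w) ^+ 2 by rewrite !expr_div_n real_normK ?num_real.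
rewrite expRN ler_pdivrMr ?expR_gt0//.
have := expR_ge1Dx (3 / 4 * (`|x| / w) ^+ 2).
by move: (`|x| / w) y0 => y y0; nra.
Qed.

Lemma gauss_cvg0 (w : R) : 0 < w ->
  gauss 0 w n.+1%:R @[n --> \oo] --> 0.
Proof.
move=> w0.
apply: (@squeeze_cvgr _ _ _ _ (fun=> 0) (fun n => (2 * w) * n.+1%:R^-1)).
- apply: nearW => n; rewrite expR_ge0/=.
  have n0 : (0 : R) < n.+1%:R by [].
  rewrite ler_pdivlMr//.
  have := gauss_le_wider n.+1%:R w0; rewrite ger0_norm// => h.
  have h2 : gauss 0 (2 * w) n.+1%:R <= 1.
    by rewrite /gauss -expR0 ler_expR oppr_le0 sqr_ge0.
  have h3 : 0 <= gauss 0 w n.+1%:R := expR_ge0 _.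
  have : n.+1%:R / w * gauss 0 w n.+1%:R <= 2 by nra.
  by rewrite mulrAC ler_pdivrMr// mulrC.
- exact: cvg_cst.
- rewrite -(mulr0 (2 * w)); apply: cvgMr; exact: cvg_harmonic.
Qed.

Lemma integrable_gauss b (w : R) : 0 < w ->
  mu.-integrable setT (EFin \o gauss b w).
Proof.
move=> w0; apply/integrableP; split; first by apply/measurable_EFinP; exact: measurable_gauss.
under eq_integral do rewrite /= ger0_norm ?expR_ge0//.
by rewrite integral_gauss// ltry.
Qed.

Lemma gaussN (w x : R) : gauss 0 w (- x) = gauss 0 w x.
Proof. by rewrite /gauss !subr0 mulNr sqrrN. Qed.

Lemma is_derive_gauss (w x : R) : w != 0 ->
  is_derive x 1 (gauss 0 w) (- (2 * x / w ^+ 2) * gauss 0 w x).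
Proof.
move=> w0.
have h1 := is_derive1_affine w^-1 0 x.
have h2 := is_derive1Zl (-1) (is_derive1M h1 h1).
have := is_derive1_chain (is_derive_expR _) h2.
have -> : (fun t => expR (-1 * ((w^-1 * t + 0) * (w^-1 * t + 0)))) = gauss 0 w.
  by apply/funext => t; rewrite /gauss; congr expR; rewrite subr0; ring.
move=> h; apply: (is_derive_eq h).
have -> : -1 * ((w^-1 * x + 0) * (w^-1 * x + 0)) = - ((x - 0) / w) ^+ 2 by ring.
by rewrite -/(gauss 0 w x); field.
Qed.

Lemma measurable_cos_affine (a c : R) : measurable_fun setT (fun x : R => cos (a * x + c)).
Proof.
apply: measurableT_comp; first exact: (continuous_measurable_fun (@continuous_cos R)).
by apply: measurable_funD => //; exact: measurable_funM.
Qed.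

Lemma integrable_gauss_cos (a c w : R) : 0 < w ->
  mu.-integrable setT (EFin \o (fun x => gauss 0 w x * cos (a * x + c))).
Proof.
move=> w0; apply: (le_integrable _ _ _ (integrable_gauss 0 w0)) => //.
  apply/measurable_EFinP; apply: measurable_funM; first exact: measurable_gauss.
  exact: measurable_cos_affine.
move=> x _ /=; rewrite lee_fin normrM ger0_norm ?expR_ge0// ler_piMr ?expR_ge0//.
by rewrite ler_norml cos_geN1 cos_le1.
Qed.

(* exp ((a w / 2)^2) times the integral is constant in [a], because
   d/da (exp ((a w / 2)^2) e^(-(x/w)^2) cos (a x + c)) is an exact [x]-derivative. *)
Lemma integral_gauss_cos (a c w : R) : 0 < w ->
  Rintegral mu setT (fun x => gauss 0 w x * cos (a * x + c)) =
  Num.sqrt pi * w * expR (- (a * w / 2) ^+ 2) * cos c.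
Proof.
move=> w0; have w1 : w != 0 by rewrite gt_eqF.
pose E (t : R) := expR ((t * w / 2) ^+ 2).
pose K (t x : R) := E t * (gauss 0 w x * cos (t * x + c)).
pose dK (t x : R) := E t * (gauss 0 w x *
  (t * w ^+ 2 / 2 * cos (t * x + c) - x * sin (t * x + c))).
have dE (t : R) : is_derive t 1 E (t * w ^+ 2 / 2 * E t).
  have h1 := is_derive1_affine (w / 2) 0 t.
  have := is_derive1_chain (is_derive_expR _) (is_derive1M h1 h1).
  have -> : (fun t => expR ((w / 2 * t + 0) * (w / 2 * t + 0))) = E.
    by apply/funext => y; rewrite /E; congr expR; field.
  move=> h; apply: (is_derive_eq h).
  have -> : (w / 2 * t + 0) * (w / 2 * t + 0) = (t * w / 2) ^+ 2 by field.
  by rewrite -/(E t); field.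
have dKt (t x : R) : is_derive t 1 (K ^~ x) (dK t x).
  have h1 := is_derive1_chain (is_derive_cos _) (is_derive1_affine x c t).
  have := is_derive1M (dE t) (is_derive1Zl (gauss 0 w x) h1).
  have -> : (fun t => E t * (gauss 0 w x * cos (x * t + c))) = K ^~ x.
    by apply/funext => y; rewrite /K [x * y]mulrC.
  by move=> h; apply: (is_derive_eq h); rewrite /dK [x * t]mulrC; ring.
have iK t : mu.-integrable setT (EFin \o K t).
  exact: (integrableZl measurableT (E t) (integrable_gauss_cos t c w0)).
(* The exact derivative: [dS t] is the x-derivative of [gauss 0 w x * sin (t * x + c)], and [dKdS]
   says that the t-derivative of [K] is a multiple of it by a factor depending on t alone. *)
pose dS (t x : R) := gauss 0 w x * (t * cos (t * x + c) - 2 * x / w ^+ 2 * sin (t * x + c)).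
have dSx (t x : R) : is_derive x 1 (fun x => gauss 0 w x * sin (t * x + c)) (dS t x).
  have h1 := is_derive1_chain (is_derive_sin _) (is_derive1_affine t c x).
  by apply: (is_derive_eq (is_derive1M (is_derive_gauss x w1) h1)); rewrite /dS; ring.
have dKdS t x : dK t x = E t * w ^+ 2 / 2 * dS t x by rewrite /dK /dS; field.
have dSle A t x : `|t| <= A -> `|dS t x| <= (A + 2 / w) * 2 * gauss 0 (2 * w) x.
  move=> tA; rewrite /dS normrM ger0_norm ?expR_ge0//.
  have A0 : 0 <= A by exact: le_trans tA.
  have cb : `|cos (t * x + c)| <= 1 by rewrite ler_norml cos_geN1 cos_le1.
  have sb : `|sin (t * x + c)| <= 1 by rewrite ler_norml sin_geN1 sin_le1.
  have h : `|t * cos (t * x + c) - 2 * x / w ^+ 2 * sin (t * x + c)| <=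
      (A + 2 / w) * (1 + `|x| / w).
    apply: (le_trans (ler_normB _ _)).
    have -> : 2 * x / w ^+ 2 = 2 / w * (x / w) by field.
    rewrite !normrM [ `|w^-1| ]ger0_norm ?invr_ge0 ?(ltW w0)//.
    rewrite [ `|2| ]ger0_norm//.
    have y0 : 0 <= `|x| / w by rewrite divr_ge0// ltW.
    have v0 : 0 <= 2 / w by rewrite divr_ge0// ltW.
    apply: (@le_trans _ _ (A + 2 / w * (`|x| / w))).
      apply: lerD; first by rewrite -[leRHS]mulr1 ler_pM.
      by rewrite ler_piMr// mulr_ge0.
    move: (2 / w) v0 (`|x| / w) y0 => v v0 y y0; nra.
  rewrite -[leRHS]mulrA; apply: (le_trans (ler_wpM2l (gauss_ge0 0 w x) h)).
  rewrite mulrCA ler_wpM2l// ?addr_ge0 ?divr_ge0// ?(ltW w0)//.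
  by rewrite mulrC gauss_le_wider.
have cdS t : continuous (dS t).
  move=> x; have ha := is_derive1_affine t c x.
  have hc := is_derive_continuous (is_derive1_chain (is_derive_cos _) ha).
  have hs := is_derive_continuous (is_derive1_chain (is_derive_sin _) ha).
  apply: cvgM; first exact: is_derive_continuous (is_derive_gauss x w1).
  apply: cvgB; first by apply: cvgM; [exact: cvg_cst|exact: hc].
  apply: cvgM; last exact: hs.
  by apply: cvgM; [apply: cvgM; [exact: cvg_cst|exact: cvg_id]|exact: cvg_cst].
have w20 : 0 < 2 * w by rewrite mulr_gt0.
have idS t : mu.-integrable setT (EFin \o dS t).
  apply: (le_integrable _ _ _
    (integrableZl measurableT ((`|t| + 2 / w) * 2) (integrable_gauss 0 w20))) => //.
    by apply/measurable_EFinP; apply: continuous_measurable_fun.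
  by move=> x _ /=; rewrite lee_fin (le_trans (dSle _ _ _ (lexx _)))// ler_norm.
have lim0 (F : nat -> R) : (forall n, `|F n| <= gauss 0 w n.+1%:R) -> F @ \oo --> 0.
  move=> Fg; apply: norm_cvg0.
  apply: (@squeeze_cvgr _ _ _ _ (fun=> 0) (fun n => gauss 0 w n.+1%:R)).
  - by apply: nearW => n; rewrite normr_ge0 Fg.
  - exact: cvg_cst.
  - exact: gauss_cvg0.
have sin1 y : `|sin y| <= 1 :> R by rewrite ler_norml sin_geN1 sin_le1.
have dS0 t : Rintegral mu setT (dS t) = 0.
  apply: (Rintegral_derive_eq0 (dSx t)) => //.
  - apply: lim0 => n; rewrite normrM ger0_norm ?gauss_ge0//.
    by rewrite ler_piMr// gauss_ge0.
  - apply: lim0 => n; rewrite gaussN normrM ger0_norm ?gauss_ge0//.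
    by rewrite ler_piMr// gauss_ge0.
(* Differentiation under the integral on the interval of radius 1 around [t], where |u| <= [A] and a
   Gaussian of width 2w dominates. The differentiated integrand integrates to zero by [dS0]. *)
have dint (t : R) : is_derive t 1 (fun t => Rintegral mu setT (K t)) 0.
  pose A := `|t| + 1.
  pose G x := expR ((A * w / 2) ^+ 2) * (w ^+ 2 / 2) *
    ((A + 2 / w) * 2 * gauss 0 (2 * w) x).
  have tI : `](t - 1), (t + 1)[%classic t by rewrite /= in_itv/= ltrBlDr ltrDl ltr01.
  have iI u : `](t - 1), (t + 1)[%classic u -> `|u| <= A.
    rewrite /= in_itv/= => /andP[h1 h2].
    have := ler_norm t; have := ler_norm (- t); rewrite normrN /A ler_norml; lra.
  have derK u y : `](t - 1), (t + 1)[%classic u -> setT y -> derivable (K ^~ y) u 1.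
    by move=> _ _; have [] := dKt u y.
  have G0 x : 0 <= G x.
    have A0 : 0 <= A by rewrite /A addr_ge0.
    have v0 : 0 <= 2 / w by rewrite divr_ge0// ltW.
    have w2 : 0 <= w ^+ 2 / 2 by rewrite divr_ge0// sqr_ge0.
    apply: mulr_ge0; first by rewrite mulr_ge0// expR_ge0.
    by rewrite !mulr_ge0 ?gauss_ge0// addr_ge0.
  have iG : mu.-integrable setT (EFin \o G).
    exact: (integrableZl measurableT _ (integrableZl measurableT _ (integrable_gauss 0 w20))).
  have dKE u y : partial1of2 K u y = dK u y.
    by rewrite /partial1of2; apply: is_derive_derive1.
  have bK u y : `](t - 1), (t + 1)[%classic u -> setT y -> `|partial1of2 K u y| <= G y.
    move=> /iI uA _; rewrite dKE dKdS normrM; apply: ler_pM => //; last exact: dSle.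
    have w2 : 0 <= w ^+ 2 / 2 by rewrite divr_ge0// sqr_ge0.
    rewrite -mulrA normrM !ger0_norm ?expR_ge0// ler_wpM2r// ler_expR.
    rewrite !expr_div_n !exprMn ler_wpM2r// ler_wpM2r ?sqr_ge0//.
    by rewrite -[u ^+ 2]real_normK ?num_real// lerXn2r ?nnegrE// (le_trans _ uA).
  have iK' u : `](t - 1), (t + 1)[%classic u -> mu.-integrable setT (EFin \o K u).
    by move=> _; exact: iK.
  have d1 := derivable_under_integral measurableT tI iK' derK G0 iG bK.
  have d2 := differentiation_under_integral measurableT tI iK' derK G0 iG bK.
  apply: DeriveDef => //; rewrite -derive1E d2.
  rewrite (_ : (fun x => _) = fun x => E t * w ^+ 2 / 2 * dS t x).
    by rewrite RintegralZl// dS0 mulr0.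
  by apply/funext => x; rewrite dKE dKdS.
(* Being constant in the frequency, the integral of [K] equals its value at frequency 0, where it is
   the plain Gaussian integral times [cos c]. *)
have := is_derive_0_is_cst a 0 dint.
rewrite /K RintegralZl//; last exact: integrable_gauss_cos.
rewrite RintegralZl//; last exact: integrable_gauss_cos.
under [in RHS]eq_Rintegral do rewrite mul0r add0r mulrC.
rewrite RintegralZl//; last exact: integrable_gauss.
rewrite [X in cos c * X]/Rintegral integral_gauss//=.
rewrite {2}/E !mul0r expr0n expR0 mul1r expRN -/(E a) => h.
have Ea : E a != 0 by rewrite lt0r_neq0// expR_gt0.
by rewrite -[LHS](mulKf Ea) h; move: (E a)^-1 => e; ring.
Qed.

End gaussian_fourier_transform.

(** * Gaussians on R^n and the wave packet *)

Section gaussians_Rn.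
Variables (R : realType).
Local Notation mu n := (lebesgue_Rn R n).

Definition gaussn n (b w : 'I_n -> R) (x : Rn R n) : R :=
  \prod_(j < n) gauss (b j) (w j) (tnth x j).

Lemma measurable_gaussn n (b w : 'I_n -> R) : measurable_fun setT (gaussn b w).
Proof.
apply: (measurable_prod_tnth (h := fun j => gauss (b j) (w j))) => j.
exact: measurable_gauss.
Qed.

Lemma gaussn_ge0 n (b w : 'I_n -> R) x : 0 <= gaussn b w x.
Proof. by apply: prodr_ge0 => j _; exact: gauss_ge0. Qed.

Lemma integral_gaussn n (b w : 'I_n -> R) : (forall j, 0 < w j) ->
  (\int[mu n]_x (gaussn b w x)%:E = (\prod_(j < n) (Num.sqrt pi * w j))%:E)%E.
Proof.
move=> w0; apply: (integral_prod (h := fun j => gauss (b j) (w j))) => j.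
- exact: measurable_gauss.
- by move=> x; exact: gauss_ge0.
- exact: integral_gauss.
Qed.

Lemma integrable_gaussn n (b w : 'I_n -> R) : (forall j, 0 < w j) ->
  (mu n).-integrable setT (EFin \o gaussn b w).
Proof.
move=> w0; apply/integrableP; split.
  by apply/measurable_EFinP; exact: measurable_gaussn.
under eq_integral do rewrite /= ger0_norm ?gaussn_ge0//.
by rewrite integral_gaussn// ltry.
Qed.

Lemma integrable_gaussn_cos n (b w : 'I_n -> R) (h : Rn R n -> R) :
  (forall j, 0 < w j) -> measurable_fun setT h ->
  (mu n).-integrable setT (EFin \o (fun x => gaussn b w x * cos (h x))).
Proof.
move=> w0 mh; apply: (le_integrable _ _ _ (integrable_gaussn b w0)) => //.
  apply/measurable_EFinP; apply: measurable_funM; first exact: measurable_gaussn.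
  apply: measurableT_comp => //; exact: (continuous_measurable_fun (@continuous_cos R)).
move=> x _ /=; rewrite lee_fin normrM ger0_norm ?gaussn_ge0//.
rewrite ler_piMr ?(ger0_norm (gaussn_ge0 _ _ _)) ?gaussn_ge0//.
by rewrite ler_norml cos_geN1 cos_le1.
Qed.

Lemma measurable_affine n (a : 'I_n -> R) (c : R) :
  measurable_fun setT (fun x : Rn R n => \sum_(j < n) a j * (tnth x j : R) + c).
Proof.
apply: measurable_funD => //; apply: measurable_sum => j.
by apply: measurable_funM => //; exact: measurable_tnth.
Qed.

(* The phase [c] carries the coordinates already integrated. *)
Lemma integral_gaussn_cos n (a w : 'I_n -> R) (c : R) : (forall j, 0 < w j) ->
  Rintegral (mu n) setT
    (fun x => gaussn (fun=> 0) w x * cos (\sum_(j < n) a j * (tnth x j : R) + c)) =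
  \prod_(j < n) (Num.sqrt pi * w j * expR (- (a j * w j / 2) ^+ 2)) * cos c.
Proof.
elim: n a w c => [|n IH] a w c w0.
  rewrite /Rintegral (integral_Rn0 (fun x => _))/= !big_ord0 /gaussn big_ord0.
  by rewrite add0r !mul1r.
have ig := integrable_gaussn_cos (fun=> 0) w0 (measurable_affine a c).
rewrite /Rintegral integral_RnS//.
pose C : R := \prod_(j < n) (Num.sqrt pi * w (lift ord0 j) *
  expR (- (a (lift ord0 j) * w (lift ord0 j) / 2) ^+ 2)).
transitivity (fine (\int[@lebesgue_measure R]_t
  (C * (gauss 0 (w ord0) t * cos (a ord0 * t + c)))%:E)).
  congr fine; apply: eq_integral => t _.
  transitivity (\int[mu n]_x ((gauss 0 (w ord0) t)%:E *
    (gaussn (fun=> 0) (fun j => w (lift ord0 j)) x *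
      cos (\sum_(j < n) a (lift ord0 j) * (tnth x j : R) + (a ord0 * t + c)))%:E))%E.
    apply: eq_integral => x _; rewrite -EFinM; congr EFin.
    rewrite /gaussn big_ord_recl tnth_consR0/= -mulrA; congr (_ * (_ * cos _)).
      by apply: eq_bigr => j _; rewrite tnth_consRS.
    rewrite big_ord_recl tnth_consR0/=.
    by under eq_bigr do rewrite tnth_consRS/=; ring.
  have iI := integrable_gaussn_cos (fun=> 0) (fun j => w0 (lift ord0 j))
    (measurable_affine (fun j => a (lift ord0 j)) (a ord0 * t + c)).
  rewrite integralZl//.
  rewrite -[X in (_ * X)%E]fineK; last exact: integrable_fin_num.
  have := IH (fun j => a (lift ord0 j)) (fun j => w (lift ord0 j)) (a ord0 * t + c)
    (fun j => w0 (lift ord0 j)).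
  rewrite /Rintegral/= => ->; rewrite -EFinM -/C; congr EFin; ring.
have iC := integrable_gauss_cos (a ord0) c (w0 ord0).
rewrite -[LHS]/(Rintegral _ setT _) RintegralZl// integral_gauss_cos//.
by rewrite big_ord_recl -/C; ring.
Qed.

Variables (n : nat) (b l : 'I_n -> R).
Hypothesis l0 : forall j, 0 < l j.

(* A wave packet at frequency [b]; its Fourier transform is a Gaussian of
   widths [l j] centred at [b]. *)
Definition packet (x : Rn R n) : R[i] :=
  real_complex R (gaussn (fun=> 0) (fun j => 2 / l j) x) *
  cis (\sum_(j < n) b j * (tnth x j : R)).

(** The integral of the envelope of the packet, hence the peak height of its Fourier transform. It
    scales like the inverse of the product of the frequency widths. *)
Definition packet_const : R := \prod_(j < n) (Num.sqrt pi * (2 / l j)).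

Let w0 j : 0 < 2 / l j.
Proof. by rewrite divr_gt0. Qed.

(** The modulation shifts the frequency to b - xi, and a spatial width 2 / l turns the factor
    exp(-((b - xi) w / 2)^2) into a Gaussian of width l around b. *)
Lemma fourier_packet xi :
  fourier packet xi = real_complex R (packet_const * gaussn b l xi).
Proof.
have E x : packet x * cis (- dot x xi) =
    real_complex R (gaussn (fun=> 0) (fun j => 2 / l j) x) *
    cis (\sum_(j < n) (b j - tnth xi j) * (tnth x j : R)).
  rewrite /packet -mulrA -cisD; congr (_ * cis _).
  rewrite /dot -sumrN -big_split/=; apply: eq_bigr => j _; ring.
have P c : Rintegral (mu n) setT (fun x =>
    gaussn (fun=> 0) (fun j => 2 / l j) x *
    cos (\sum_(j < n) (b j - tnth xi j) * (tnth x j : R) + c)) =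
    packet_const * gaussn b l xi * cos c.
  rewrite (integral_gaussn_cos (fun j => b j - tnth xi j))// /packet_const /gaussn.
  rewrite -big_split/=; congr (_ * _); apply: eq_bigr => j _; congr (_ * expR _).
  by have := l0 j => lj; congr (- _); field; lra.
rewrite /fourier (funext E) /cintegral; apply: complex_ext => /=.
- rewrite -[RHS]mulr1 -[X in _ = _ * X]cos0 -P; apply: eq_Rintegral => x _.
  by rewrite mul0r subr0 addr0.
(* A sine is a cosine with phase -pi/2, so the imaginary part is the same integral with c = -pi/2,
   which vanishes. *)
- transitivity (packet_const * gaussn b l xi * cos (- (pi / 2))).
    rewrite -P; apply: eq_Rintegral => x _.
    rewrite mul0r addr0; congr (_ * _).
    by rewrite cosB cos_pihalf sin_pihalf mulr0 add0r mulr1.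
  by rewrite cosN cos_pihalf mulr0.
Qed.

End gaussians_Rn.

(** * Derivatives and decay of modulated Gaussians times polynomials *)

Section gaussian_polynomials.
Variable R : realType.

Lemma is_derive1_ext (f g : R -> R) (x df : R) : f =1 g ->
  is_derive x 1 g df -> is_derive x 1 f df.
Proof. by move=> /funext ->. Qed.

Lemma is_derive1N (f : R -> R) (x df : R) :
  is_derive x 1 f df -> is_derive x 1 (fun y => - f y) (- df).
Proof. by move=> hf; exact: is_deriveN. Qed.

Definition cderivative (h h' : R -> R[i]) : Prop := forall x : R,
  is_derive x 1 (fun y => complex.Re (h y)) (complex.Re (h' x)) /\
  is_derive x 1 (fun y => complex.Im (h y)) (complex.Im (h' x)).

Lemma cderivativeM h h' k k' : cderivative h h' -> cderivative k k' ->
  cderivative (fun y => h y * k y) (fun y => h' y * k y + h y * k' y).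
Proof.
move=> dh dk x; have [hr hi] := dh x; have [kr ki] := dk x; split.
- apply: (is_derive1_ext (g := fun y => complex.Re (h y) * complex.Re (k y) -
    complex.Im (h y) * complex.Im (k y)))   => [y|]; first exact: (complexReM (h y) (k y)).
  apply: (is_derive_eq (is_derive1D (is_derive1M hr kr) (is_derive1N (is_derive1M hi ki)))).
  by rewrite complexReD !complexReM; ring.
- apply: (is_derive1_ext (g := fun y => complex.Re (h y) * complex.Im (k y) +
    complex.Im (h y) * complex.Re (k y))) => [y|]; first exact: (complexImM (h y) (k y)).
  apply: (is_derive_eq (is_derive1D (is_derive1M hr ki) (is_derive1M hi kr))).
  by rewrite complexImD !complexImM; ring.
Qed.

Lemma cderivativeD h h' k k' : cderivative h h' -> cderivative k k' ->
  cderivative (fun y => h y + k y) (fun y => h' y + k' y).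
Proof.
move=> dh dk x; have [hr hi] := dh x; have [kr ki] := dk x; split.
- by rewrite complexReD; apply: (is_derive1_ext (g := fun y => complex.Re (h y) + complex.Re (k y))) => y;
    exact: (complexReD (h y) (k y)).
- by rewrite complexImD; apply: (is_derive1_ext (g := fun y => complex.Im (h y) + complex.Im (k y))) => y;
    exact: (complexImD (h y) (k y)).
Qed.

Lemma cderivative_cst (c : R[i]) : cderivative (fun=> c) (fun=> 0).
Proof. by move=> x; split; exact: is_derive_cst. Qed.

Lemma cderivative_real (g g' : R -> R) : (forall x : R, is_derive x 1 g (g' x)) ->
  cderivative (fun y => real_complex R (g y)) (fun y => real_complex R (g' y)).
Proof. by move=> dg x; split => //=; exact: is_derive_cst. Qed.

Lemma cderivative_cis (b : R) :
  cderivative (fun y => cis (b * y)) (fun y => Complex 0 b * cis (b * y)).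
Proof.
move=> x; have h := is_derive1_affine b 0 x.
split; rewrite ?complexReM ?complexImM /=.
- apply: (is_derive1_ext (g := fun y => cos (b * y + 0))) => [y|]; first by rewrite addr0.
  by apply: (is_derive_eq (is_derive1_chain (is_derive_cos _) h)); rewrite addr0; ring.
- apply: (is_derive1_ext (g := fun y => sin (b * y + 0))) => [y|]; first by rewrite addr0.
  by apply: (is_derive_eq (is_derive1_chain (is_derive_sin _) h)); rewrite addr0; ring.
Qed.

(** Complex polynomials times exp(-(y/w)^2 + i b y), generated by closure rules. Stability under
    differentiation and decay then both go by induction, without explicit Hermite polynomials. *)
Inductive gausspoly (w b : R) : (R -> R[i]) -> Prop :=
| gausspoly_base : gausspoly w b (fun y => real_complex R (gauss 0 w y) * cis (b * y))
| gausspolyX h : gausspoly w b h -> gausspoly w b (fun y => real_complex R y * h y)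
| gausspolyZ c h : gausspoly w b h -> gausspoly w b (fun y => c * h y)
| gausspolyD h k : gausspoly w b h -> gausspoly w b k ->
    gausspoly w b (fun y => h y + k y).

Lemma gausspoly_derivative w b h : w != 0 -> gausspoly w b h ->
  exists2 h', gausspoly w b h' & cderivative h h'.
Proof.
move=> w0; elim=> [|{}h gh [h' gh' dh]|c {}h gh [h' gh' dh]|{}h k gh [h' gh' dh] gk [k' gk' dk]].
- pose h0 y := real_complex R (gauss 0 w y) * cis (b * y).
  exists (fun y => real_complex R (- (2 / w ^+ 2)) * (real_complex R y * h0 y) +
    Complex 0 b * h0 y).
    by apply: gausspolyD; apply: gausspolyZ; [apply: gausspolyX|]; exact: gausspoly_base.
  have := cderivativeM (cderivative_real (fun x => is_derive_gauss x w0))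
    (cderivative_cis b).
  congr cderivative; apply/funext => y; rewrite /h0.
  have -> : - (2 * y / w ^+ 2) * gauss 0 w y = - (2 / w ^+ 2) * (y * gauss 0 w y).
    by field.
  rewrite 2!rmorphM; ring.
- exists (fun y => real_complex R 1 * h y + real_complex R y * h' y).
    by apply: gausspolyD; [exact: gausspolyZ|exact: gausspolyX].
  exact: (cderivativeM (cderivative_real (fun x => is_derive_id x 1)) dh).
- exists (fun y => 0 * h y + c * h' y).
    by apply: gausspolyD; exact: gausspolyZ.
  exact: (cderivativeM (cderivative_cst c) dh).
- exists (fun y => h' y + k' y); first exact: gausspolyD.
  exact: cderivativeD.
Qed.

(** Each power of 1 + |y| is paid for by doubling the width through [gauss_le_wider]; the induction
    therefore ranges over all widths. *)
Lemma gauss_decay (w : R) N : 0 < w ->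
  exists M : R, forall y, (1 + `|y|) ^+ N * gauss 0 w y <= M.
Proof.
elim: N w => [|N IH] w w0.
  by exists 1 => y; rewrite mul1r /gauss -expR0 ler_expR oppr_le0 sqr_ge0.
have [|M hM] := IH (2 * w); first by rewrite mulr_gt0.
exists ((1 + w) * 2 * M) => y.
have h := gauss_le_wider y w0.
have h1 : 1 + `|y| <= (1 + w) * (1 + `|y| / w).
  have -> : (1 + w) * (1 + `|y| / w) = 1 + `|y| + w + `|y| / w by field; lra.
  by rewrite -addrA lerDl addr_ge0 ?(ltW w0)// divr_ge0// ltW.
have h2 : (1 + `|y|) * gauss 0 w y <= (1 + w) * 2 * gauss 0 (2 * w) y.
  apply: (le_trans (ler_wpM2r (gauss_ge0 0 w y) h1)).
  rewrite -!mulrA ler_wpM2l// addr_ge0// ltW//.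
rewrite exprSr -mulrA.
apply: (@le_trans _ _ ((1 + `|y|) ^+ N * ((1 + w) * 2 * gauss 0 (2 * w) y))).
  by rewrite ler_wpM2l// exprn_ge0// addr_ge0.
by rewrite mulrCA ler_wpM2l// mulr_ge0// addr_ge0// ltW.
Qed.

Lemma gausspoly_decay w b h N : 0 < w -> gausspoly w b h ->
  exists M : R, forall y, (1 + `|y|) ^+ N * cabs (h y) <= M.
Proof.
move=> w0 gh; elim: gh N => [|{}h _ IH|c {}h _ IH|{}h k _ IHh _ IHk] N.
- have [M hM] := gauss_decay N w0; exists M => y.
  by rewrite cabsM cabs_real cabs_cis mulr1 (ger0_norm (gauss_ge0 _ _ _)) hM.
- have [M hM] := IH N.+1; exists M => y; apply: le_trans (hM y).
  rewrite cabsM cabs_real exprSr -mulrA ler_wpM2l ?exprn_ge0 ?addr_ge0//.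
  by rewrite ler_wpM2r ?cabs_ge0// lerDr.
- have [M hM] := IH N; exists (cabs c * M) => y.
  by rewrite cabsM mulrCA ler_wpM2l ?cabs_ge0.
- have [M hM] := IHh N; have [M' hM'] := IHk N; exists (M + M') => y.
  apply: le_trans (lerD (hM y) (hM' y)).
  by rewrite -mulrDr ler_wpM2l ?ler_cabsD// exprn_ge0// addr_ge0.
Qed.

End gaussian_polynomials.

(** * The packet is a Schwartz function *)

Section packet_schwartz.
Variables (R : realType) (n : nat).

(** Lets the weight (1 + |x|)^N be distributed over the coordinates, so that decay of a product
    function reduces to decay of its one-variable factors. It passes through |x| <= sum |x_j| and 1
    + sum |x_j| <= prod (1 + |x_j|). *)
Lemma enormS_le (x : Rn R n) : 1 + enorm x <= \prod_(j < n) (1 + `|tnth x j : R|).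
Proof.
have h1 : enorm x <= \sum_(j < n) `|tnth x j : R|.
  have s0 : 0 <= \sum_(j < n) `|tnth x j : R| by apply: sumr_ge0.
  rewrite -ler_sqr ?nnegrE ?enorm_ge0// sqr_sqrtr; last first.
    by apply: sumr_ge0 => j _; rewrite -expr2 sqr_ge0.
  rewrite /dot.
  have [] : 0 <= \sum_(j < n) `|tnth x j : R| /\
      \sum_(j < n) tnth x j * tnth x j <= (\sum_(j < n) `|tnth x j : R|) ^+ 2; last by [].
  elim/big_rec2: _ => [|j a c _ [c0 ac]]; first by rewrite expr0n.
  have e : (tnth x j : R) * tnth x j = `|tnth x j : R| ^+ 2.
    by rewrite real_normK ?num_real.
  by rewrite e; have := normr_ge0 (tnth x j : R); split; nra.
apply: (@le_trans _ _ (1 + \sum_(j < n) `|tnth x j : R|)); first by rewrite lerD2l.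
have [] : 0 <= \sum_(j < n) `|tnth x j : R| /\
    1 + \sum_(j < n) `|tnth x j : R| <= \prod_(j < n) (1 + `|tnth x j : R|); last by [].
elim/big_rec2: _ => [|j a c _ [c0 ac]]; first by rewrite addr0.
by have := normr_ge0 (tnth x j : R); split; nra.
Qed.

Variables (w b : 'I_n -> R).
Hypothesis w0 : forall j, 0 < w j.

(** A partial derivative alters one factor only and keeps it in its [gausspoly] class, so iterated
    partial derivatives stay in this class. *)
Definition packet_class (f : Rn R n -> R[i]) : Prop :=
  exists2 h : 'I_n -> R -> R[i], (forall j, gausspoly (w j) (b j) (h j)) &
    forall x, f x = \prod_(j < n) h j (tnth x j).

Lemma packet_class_partial i f : packet_class f ->
  has_partial i f /\ packet_class (partial i f).
Proof.
move=> [h gh fE].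
have [h' gh' dh] := gausspoly_derivative (lt0r_neq0 (w0 i)) (gh i).
have E x t : f (translate i x t) =
    h i (tnth x i + t) * \prod_(j < n | j != i) h j (tnth x j).
  rewrite fE (bigD1 i)//= tnth_mktuple eqxx; congr (_ * _).
  by apply: eq_bigr => j /negPf ji; rewrite tnth_mktuple ji addr0.
have D x : cderivative (fun t => f (translate i x t))
    (fun t => h' (tnth x i + t) * \prod_(j < n | j != i) h j (tnth x j)).
  have d1 : cderivative (fun t => h i (tnth x i + t)) (fun t => h' (tnth x i + t)).
    move=> t; have [dr di] := dh (tnth x i + t).
    have e : is_derive t 1 (fun t : R => tnth x i + t) 1.
      rewrite -[X in is_derive _ _ _ X]add0r.
      exact: is_derive1D.
    split.
      rewrite -[X in is_derive _ _ _ X]mulr1.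
      exact: (is_derive1_chain (f := fun y => complex.Re (h i y))).
    rewrite -[X in is_derive _ _ _ X]mulr1.
    exact: (is_derive1_chain (f := fun y => complex.Im (h i y))).
  have := cderivativeM d1 (cderivative_cst (\prod_(j < n | j != i) h j (tnth x j))).
  rewrite (_ : (fun y => h' _ * _ + _) = fun t => h' (tnth x i + t) *
    \prod_(j < n | j != i) h j (tnth x j)); last first.
    by apply/funext => y; rewrite mulr0 addr0.
  by rewrite (_ : (fun t => f _) = fun y => h i (tnth x i + y) *
    \prod_(j < n | j != i) h j (tnth x j))//; apply/funext => t; rewrite E.
split.
  by move=> x; have [[dr _] [di _]] := D x 0.
exists (fun j => if j == i then h' else h j).
  by move=> j; case: eqP => [->|_].
move=> x; have [dr di] := D x 0.
rewrite (bigD1 i)//= eqxx.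
rewrite (eq_bigr (fun j => h j (tnth x j))); last by move=> j /negPf ->.
apply: complex_ext => /=.
- by rewrite (is_derive_derive1 dr) addr0.
- by rewrite (is_derive_derive1 di) addr0.
Qed.

Lemma packet_class_partials s f : packet_class f -> packet_class (partials s f).
Proof.
by move=> pf; elim: s => //= i s IH; have [_] := packet_class_partial i IH.
Qed.

Lemma packet_class_decay N f : packet_class f ->
  exists M : R, forall x, (1 + enorm x) ^+ N * cabs (f x) <= M.
Proof.
move=> [h gh fE].
have /choice[M hM] : forall j, exists M : R,
    forall y, (1 + `|y|) ^+ N * cabs (h j y) <= M.
  by move=> j; exact: gausspoly_decay (w0 j) (gh j).
exists (\prod_(j < n) M j) => x.
have -> : cabs (f x) = \prod_(j < n) cabs (h j (tnth x j)).
  rewrite fE; apply: (big_morph (@cabs R)) => [|]; first exact: cabsM.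
  by rewrite cabsE /= expr0n addr0 expr1n sqrtr1.
apply: (@le_trans _ _ ((\prod_(j < n) (1 + `|tnth x j : R|)) ^+ N *
    \prod_(j < n) cabs (h j (tnth x j)))).
  rewrite ler_wpM2r ?prodr_ge0// => [j _|]; first exact: cabs_ge0.
  rewrite lerXn2r ?enormS_le// nnegrE ?addr_ge0 ?enorm_ge0//.
  by rewrite prodr_ge0// => j _; rewrite addr_ge0.
rewrite -prodrXl -big_split/=; apply: ler_prod => j _; rewrite hM andbT.
by rewrite mulr_ge0 ?cabs_ge0// exprn_ge0// addr_ge0.
Qed.

(** The order [K] of differentiation is separated from the weight exponent [N], which
    [schwartz_bound] ties together, so that induction on [K] can keep [N] fixed. *)
Lemma packet_class_bound K N f : packet_class f ->
  exists M : R, forall s : seq 'I_n, (size s <= K)%N ->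
    forall x, (1 + enorm x) ^+ N * cabs (partials s f x) <= M.
Proof.
elim: K f => [|K IH] f pf.
  have [M hM] := packet_class_decay N pf; exists M => s.
  by rewrite leqn0 => /nilP ->; exact: hM.
have [M0 hM0] := packet_class_decay N pf.
have /choice[M hM] : forall i, exists M : R, forall s : seq 'I_n, (size s <= K)%N ->
    forall x, (1 + enorm x) ^+ N * cabs (partials s (partial i f) x) <= M.
  by move=> i; apply: IH; have [] := packet_class_partial i pf.
exists (`|M0| + \sum_i `|M i|) => s.
(* [partials] applies the last index of the list first, so peeling from the right exposes
   [partial i f], to which the induction hypothesis applies; summing over the finitely many i gives
   one bound. *)
case/lastP: s => [_ x|s i].
  apply: (le_trans (hM0 x)); rewrite (le_trans (ler_norm _))// lerDl.
  exact: sumr_ge0.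
rewrite size_rcons ltnS => sK x; rewrite /partials foldr_rcons.
apply: (le_trans (hM i s sK x)); rewrite (le_trans (ler_norm _))//.
rewrite (bigD1 i)//= addrCA lerDl addr_ge0//; exact: sumr_ge0.
Qed.

Lemma packet_class_schwartz f : packet_class f -> schwartz f.
Proof.
move=> pf; split=> [s i|N]; last exact: packet_class_bound.
by have [] := packet_class_partial i (packet_class_partials s pf).
Qed.

End packet_schwartz.

Lemma schwartz_packet (R : realType) n (b l : 'I_n -> R) : (forall j, 0 < l j) ->
  schwartz (packet b l).
Proof.
move=> l0; apply: (@packet_class_schwartz _ _ (fun j => 2 / l j) b).
  by move=> j; rewrite divr_gt0.
exists (fun j y => real_complex R (gauss 0 (2 / l j) y) * cis (b j * y)).
  by move=> j; exact: gausspoly_base.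
move=> x; rewrite big_split/= /packet /gaussn; congr (_ * _).
  exact: rmorph_prod.
by apply: (big_morph (@cis R)); [exact: cisD|exact: cis0].
Qed.

(** * A Schwartz function as a tempered distribution *)

Section regular_distribution.
Variables (R : realType) (n : nat).
Local Notation mu := (lebesgue_Rn R n).

Definition fun_dist (f : Rn R n -> R[i]) : functional R n :=
  fun phi => cintegral setT (fun x => f x * phi x).

Variable f : Rn R n -> R[i].
Hypothesis sf : schwartz f.

Lemma cintegrable_schwartzM phi : schwartz phi ->
  cintegrable setT (fun x => f x * phi x).
Proof.
move=> sphi; have [_ /(_ 0%N)[M Mb]] := sphi.
apply: (cintegrable_le _ (integrableZl measurableT M (schwartz_integrable sf))).
  by apply: cmeasurableM; exact: schwartz_cmeasurable.
move=> x; rewrite cabsM mulrC ler_wpM2r ?cabs_ge0//.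
exact: schwartz_bounded Mb x.
Qed.

Lemma is_function_fun_dist : is_function (fun_dist f) f.
Proof.
split; first exact: schwartz_cmeasurable.
by move=> phi sphi; split=> //; exact: cintegrable_schwartzM.
Qed.

Lemma tempered_fun_dist : tempered (fun_dist f).
Proof.
split.
  move=> a phi psi sphi spsi; rewrite /fun_dist.
  rewrite -cintegralZ; last exact: cintegrable_schwartzM.
  rewrite -cintegralD; last exact: cintegrable_schwartzM.
    by congr cintegral; apply/funext => x; ring.
  exact/cintegrableZ/cintegrable_schwartzM.
(* A distribution of order 0: pairing with [phi] is bounded by the sup norm of [phi] times twice the
   L^1 norm of [f]. *)
exists 0%N, (2 * Rintegral mu setT (fun x => cabs (f x))) => phi M sphi Mb.
have If := schwartz_integrable sf.
rewrite -mulrA [_ * M]mulrC -RintegralZl//.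
apply: cabs_cintegral_le; first exact: cintegrable_schwartzM.
- exact: (integrableZl measurableT M If).
- move=> x; rewrite cabsM mulrC ler_wpM2r ?cabs_ge0//.
  exact: schwartz_bounded Mb x.
Qed.

Lemma measurable_fst_snd (g : Rn R n -> R) : measurable_fun setT g ->
  measurable_fun setT (fun z : Rn R n * Rn R n => g z.1) /\
  measurable_fun setT (fun z : Rn R n * Rn R n => g z.2).
Proof. by move=> mg; split; apply: measurableT_comp. Qed.

Lemma measurable_dot2 : measurable_fun setT (fun z : Rn R n * Rn R n => dot z.2 z.1).
Proof.
apply: measurable_sum => j; apply: measurable_funM.
- by apply: (measurableT_comp (measurable_tnth j)).
- by apply: (measurableT_comp (measurable_tnth j)).
Qed.

(** The multiplication formula: Fubini for f(x) phi(xi) exp(-i x.xi), dominated by |f| |phi|. It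
    identifies the distributional Fourier transform of [f] with the function [fourier f]. *)
Lemma fourier_swap phi : schwartz phi ->
  cintegral setT (fun x => f x * fourier phi x) =
  cintegral setT (fun xi => fourier f xi * phi xi).
Proof.
move=> sphi.
have If := schwartz_integrable sf; have Ip := schwartz_integrable sphi.
have [mfr mfi] := schwartz_cmeasurable sf.
have [mpr mpi] := schwartz_cmeasurable sphi.
have mc : measurable_fun setT (fun z : Rn R n * Rn R n => cos (- dot z.2 z.1)).
  apply: measurableT_comp; first exact: (continuous_measurable_fun (@continuous_cos R)).
  by apply: measurableT_comp => //; exact: measurable_dot2.
have ms : measurable_fun setT (fun z : Rn R n * Rn R n => sin (- dot z.2 z.1)).
  apply: measurableT_comp; first exact: (continuous_measurable_fun (@continuous_sin R)).
  by apply: measurableT_comp => //; exact: measurable_dot2.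
pose K (z : Rn R n * Rn R n) := f z.1 * (phi z.2 * cis (- dot z.2 z.1)).
have cint (g : Rn R n -> R[i]) (x : Rn R n) : schwartz g ->
    cintegrable setT (fun y => g y * cis (- dot y x)).
  move=> sg; apply: (cintegrable_le _ (schwartz_integrable sg)).
    apply: cmeasurableM; first exact: schwartz_cmeasurable.
    apply: cmeasurable_cis; apply: measurableT_comp => //.
    by under eq_fun do rewrite dotC; exact: measurable_dot.
  by move=> y; rewrite cabsM cabs_cis mulr1.
transitivity (cintegral setT (fun x => cintegral setT (fun xi => K (x, xi)))).
  congr cintegral; apply/funext => x.
  by rewrite /fourier -cintegralZ//; exact: cint.
have [f1r _] := measurable_fst_snd mfr; have [f1i _] := measurable_fst_snd mfi.
have [_ p2r] := measurable_fst_snd mpr; have [_ p2i] := measurable_fst_snd mpi.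
rewrite (cintegral_swap (h := fun x => cabs (f x)) (g := fun x => cabs (phi x)))//.
- congr cintegral; apply/funext => xi.
  rewrite /fourier mulrC -cintegralZ; last exact: cint.
  by congr cintegral; apply/funext => x; rewrite /K/= dotC; ring.
- rewrite /K; under eq_fun do rewrite !(complexReM, complexImM)/=.
  by apply: measurable_funB; apply: measurable_funM => //;
    [apply: measurable_funB|apply: measurable_funD]; apply: measurable_funM.
- rewrite /K; under eq_fun do rewrite !(complexReM, complexImM)/=.
  by apply: measurable_funD; apply: measurable_funM => //;
    [apply: measurable_funD|apply: measurable_funB]; apply: measurable_funM.
- by move=> x; exact: cabs_ge0.
- by move=> x; exact: cabs_ge0.
- by move=> x xi; rewrite /K/= !cabsM cabs_cis mulr1.
Qed.

End regular_distribution.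

(** * The Sobolev norm of the packet *)

Section packet_sobolev.
Variables (R : realType) (n : nat) (b l : 'I_n -> R).
Hypothesis l0 : forall j, 0 < l j.
Local Notation mu := (lebesgue_Rn R n).
Local Notation f := (packet b l).

Let sf : schwartz f. Proof. exact: schwartz_packet. Qed.

Lemma packet_const_gt0 : 0 < packet_const l.
Proof.
by apply: prodr_gt0 => j _; rewrite mulr_gt0 ?sqrtr_gt0 ?pi_gt0 ?divr_gt0.
Qed.

Lemma packet_constM : packet_const l * \prod_(j < n) (Num.sqrt pi * l j) = (2 * pi) ^+ n.
Proof.
rewrite /packet_const -big_split/= -[n in RHS]card_ord -prodr_const.
apply: eq_bigr => j _.
rewrite -[pi in RHS]sqr_sqrtr ?pi_ge0//; field; exact: lt0r_neq0.
Qed.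

Lemma is_function_fourier_packet : is_function (fourier_dist (fun_dist f)) (fourier f).
Proof.
have mF : cmeasurable setT (fourier f).
  split.
    under eq_fun do rewrite fourier_packet//=.
    by apply: measurable_funM => //; exact: measurable_gaussn.
  by under eq_fun do rewrite fourier_packet//=; exact: measurable_cst.
split => // phi sphi; split; last exact: fourier_swap.
have [_ /(_ 0%N)[M Mb]] := sphi.
apply: (cintegrable_le _ (integrableZl measurableT (M * packet_const l)
  (integrable_gaussn b l0))).
  by apply: cmeasurableM => //; exact: schwartz_cmeasurable.
move=> x; rewrite fourier_packet// cabsM cabs_real mulrC -mulrA.
rewrite ger0_norm ?mulr_ge0 ?gaussn_ge0 ?(ltW packet_const_gt0)//.
rewrite ler_wpM2r ?mulr_ge0 ?gaussn_ge0 ?(ltW packet_const_gt0)//.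
exact: schwartz_bounded Mb x.
Qed.

(* [B] stands for N^2 where N bounds the size of the frequencies. *)
Lemma sobolev_integral_packet (s B : R) : s <= 1 -> 0 < B ->
  (forall xi, 1 + enorm xi ^+ 2 <=
     B * (1 + \sum_(j < n) ((tnth xi j - b j) / l j) ^+ 2)) -> 1 <= B ->
  (sobolev_integral s (fourier f) <=
    (B `^ Num.max s 0 * packet_const l ^+ 2 *
      \prod_(j < n) (Num.sqrt pi * l j))%:E)%E.
Proof.
move=> s1 B0 hB B1.
rewrite /sobolev_integral.
have m0 : 0 <= Num.max s 0 by rewrite le_max lexx orbT.
have m1 : Num.max s 0 <= 1 by rewrite ge_max s1 ler01.
pose C := B `^ Num.max s 0 * packet_const l ^+ 2.
have C0 : 0 <= C by rewrite mulr_ge0 ?powR_ge0 ?sqr_ge0.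
apply: (@le_trans _ _ (\int[mu]_xi (C%:E * (gaussn b l xi)%:E))%E); last first.
  rewrite ge0_integralZl_EFin//.
  - by rewrite integral_gaussn// -EFinM.
  - by move=> x _; rewrite lee_fin gaussn_ge0.
  - by apply/measurable_EFinP; exact: measurable_gaussn.
apply: ge0_le_integral => //.
- by move=> x _; rewrite lee_fin mulr_ge0 ?powR_ge0 ?sqr_ge0.
- apply/measurable_EFinP; apply: measurable_funM.
    apply: (@measurableT_comp _ _ _ _ _ _ (fun y : R => y `^ s)).
      exact: measurable_powR.
    by apply: measurable_funD => //; apply: measurable_funX; exact: measurable_enorm.
  by apply: measurable_funX; apply: measurable_cabs; case: is_function_fourier_packet.
- by apply/measurable_EFinP; apply: measurable_funM => //; exact: measurable_gaussn.
move=> xi _; rewrite -EFinM lee_fin fourier_packet// cabs_real real_normK ?num_real//.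
set S := \sum_(j < n) ((tnth xi j - b j) / l j) ^+ 2.
have S0 : 0 <= S by apply: sumr_ge0 => j _; exact: sqr_ge0.
have gE : gaussn b l xi = expR (- S).
  rewrite /gaussn /S -sumrN expR_sum.
  by apply: eq_bigr => j _.
have e1 : 1 <= 1 + enorm xi ^+ 2 by rewrite lerDl sqr_ge0.
(* As 0 <= max(s, 0) <= 1, the weight is at most B^max(s,0) (1 + S). Since 1 + S <= exp(S), it
   consumes only one of the two factors exp(-S) in the squared transform, and an integrable Gaussian
   remains. *)
have h : (1 + enorm xi ^+ 2) `^ s <= B `^ Num.max s 0 * expR S.
  apply: (@le_trans _ _ ((1 + enorm xi ^+ 2) `^ Num.max s 0)).
    by rewrite ler_powR// le_max lexx.
  apply: (@le_trans _ _ ((B * (1 + S)) `^ Num.max s 0)).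
    by rewrite ge0_ler_powR ?nnegrE ?mulr_ge0 ?addr_ge0 ?(ltW B0) ?sqr_ge0.
  rewrite powRM ?addr_ge0 ?(ltW B0)// ler_wpM2l ?powR_ge0//.
  apply: le_trans (expR_ge1Dx S).
  rewrite -[leRHS]powRr1 ?addr_ge0// ler_powR// lerDl//.
rewrite gE /C; move: (expR_ge0 (- S)) h; set g := expR (- S) => g0.
have -> : expR S = g^-1 by rewrite /g expRN invrK.
have gn : g != 0 by rewrite lt0r_neq0// expR_gt0.
set P := (X in X <= _ -> _); set D := B `^ _; set c := packet_const l => h.
have -> : P * (c * g) ^+ 2 = P * g * (g * c ^+ 2) by ring.
have -> : D * c ^+ 2 * g = D * (g * c ^+ 2) by ring.
rewrite ler_wpM2r//; first by rewrite mulr_ge0// sqr_ge0.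
by apply: (le_trans (ler_wpM2r g0 h)); rewrite mulfVK.
Qed.

(** By [packet_constM] the masses of the envelope and of the frequency Gaussian multiply to (2
    pi)^n. This cancels the normalisation of the norm together with one of the two factors
    [packet_const l]. *)
Lemma sobolev_packet (s B : R) : s <= 1 -> 0 < B ->
  (forall xi, 1 + enorm xi ^+ 2 <=
     B * (1 + \sum_(j < n) ((tnth xi j - b j) / l j) ^+ 2)) -> 1 <= B ->
  exists r : R, [/\ sobolev s (fun_dist f) r, 0 <= r &
    r ^+ 2 <= B `^ Num.max s 0 * packet_const l].
Proof.
move=> s1 B0 hB B1; have I := sobolev_integral_packet s1 B0 hB B1.
exists (Num.sqrt ((2 * pi) ^- n * fine (sobolev_integral s (fourier f)))).
have I0 : (0 <= sobolev_integral s (fourier f))%E.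
  apply: integral_ge0 => x _; rewrite lee_fin.
  by rewrite mulr_ge0 ?powR_ge0 ?sqr_ge0.
have p0 : 0 <= (2 * pi : R) ^- n.
  by rewrite invr_ge0 exprn_ge0// mulr_ge0// pi_ge0.
split => //.
- split; first exact: tempered_fun_dist.
  exists (fourier f); split => //; first exact: is_function_fourier_packet.
  by apply: (le_lt_trans I); rewrite ltry.
rewrite sqr_sqrtr; last by rewrite mulr_ge0// fine_ge0.
have p2 : (2 * pi : R) ^+ n != 0 by rewrite expf_neq0// mulf_neq0// lt0r_neq0// pi_gt0.
rewrite mulrC ler_pdivrMr; last by rewrite lt_neqAle eq_sym p2 -invr_ge0.
rewrite -packet_constM mulrA -[_ * packet_const l * packet_const l]mulrA -expr2 -lee_fin fineK//.
by rewrite ge0_fin_numE// (le_lt_trans I)// ltry.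
Qed.

End packet_sobolev.

(** * A lower bound for the evolution when the phase is nearly constant *)

Section evolution_lower_bound.
Variable R : realType.

Lemma norm_sin_le (x : R) : `|sin x| <= `|x|.
Proof.
wlog x0 : x / 0 <= x.
  move=> h; have [/h//|/ltW] := leP 0 x.
  by rewrite -oppr_ge0 => /h; rewrite sinN !normrN.
have [c _ h] := @MVT_segment _ (@sin R) (@cos R) 0 x x0
  (fun y _ => is_derive_sin y) (continuous_subspaceT (@continuous_sin R)).
move: h; rewrite sin0 !subr0 => ->; rewrite normrM ler_piMl//.
by rewrite ler_norml cos_geN1 cos_le1.
Qed.

Lemma cos_ge (x : R) : 1 - x ^+ 2 / 2 <= cos x.
Proof.
have -> : cos x = 1 - 2 * sin (x / 2) ^+ 2.
  by rewrite {1}[x]splitr cosD -!expr2 cos2sin2; ring.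
have := norm_sin_le (x / 2); rewrite -ler_sqr ?nnegrE// !real_normK ?num_real//.
by rewrite expr_div_n; lra.
Qed.

Lemma measurable_peval n (P : mpoly n R) : measurable_fun setT (fun x : Rn R n => peval P x).
Proof.
under eq_fun do rewrite /peval mpoly.mevalE.
apply: measurable_sum => m; apply: measurable_funM; first exact: measurable_cst.
by apply: (measurable_prod_tnth (h := fun i y => y ^+ m i)) => i; exact: exprn_measurable.
Qed.

Variables (n : nat) (b l : 'I_n -> R).
Hypothesis l0 : forall j, 0 < l j.
Local Notation mu := (lebesgue_Rn R n).

(** Rotating by -th leaves the integral of Gaussian times cos(ph), and cos(ph) >= 1 - ph^2 / 2. The
    growth exp(S/4) allowed for the phase error becomes exp(S/2) when squared, and the Gaussian
    absorbs it by widening by a factor sqrt 2 in each direction. The loss is at most kap^2 sqrt(2)^n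
    / 2 <= 1/2 of the total mass. *)
Lemma evolution_packet_ge (P : mpoly n R) (t : R) (x : Rn R n) (th kap : R) :
  (forall xi : Rn R n, `|dot x xi + peval P xi * t - th| <=
    kap * expR ((\sum_(j < n) ((tnth xi j - b j) / l j) ^+ 2) / 4)) ->
  kap ^+ 2 * Num.sqrt 2 ^+ n <= 1 ->
  1 / 2 <= cabs (evolution P t (packet b l) x).
Proof.
move=> hth hkap.
have s20 : 0 < Num.sqrt 2 :> R by rewrite sqrtr_gt0.
have l20 j : 0 < Num.sqrt 2 * l j by rewrite mulr_gt0.
have pc0 := packet_const_gt0 l0.
pose ph xi := dot x xi + peval P xi * t - th.
have mph : measurable_fun setT ph.
  apply: measurable_funB => //; apply: measurable_funD; first exact: measurable_dot.
  by apply: measurable_funM => //; exact: measurable_peval.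
have p2 : 0 < (2 * pi : R) ^+ n by rewrite exprn_gt0// mulr_gt0// pi_gt0.
rewrite /evolution cabsM cabs_real ger0_norm ?invr_ge0 ?(ltW p2)//.
rewrite -[cabs (cintegral _ _)]mul1r -[X in _ * (X * _)](cabs_cis (- th)) -cabsM.
have iF : cintegrable setT (fun xi => fourier (packet b l) xi * cis (dot x xi + peval P xi * t)).
  apply: (cintegrable_le _ (integrableZl measurableT (packet_const l)
    (integrable_gaussn b l0))).
    apply: cmeasurableM; first by case: (is_function_fourier_packet b l0).
    apply: cmeasurable_cis; apply: measurable_funD; first exact: measurable_dot.
    by apply: measurable_funM => //; exact: measurable_peval.
  move=> xi; rewrite fourier_packet// cabsM cabs_cis mulr1 cabs_real.
  by rewrite ger0_norm// mulr_ge0 ?gaussn_ge0// ltW.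
rewrite -cintegralZ//.
apply: (@le_trans _ _ ((2 * pi) ^- n * Rintegral mu setT
    (fun xi => packet_const l * (gaussn b l xi * cos (ph xi))))); last first.
  rewrite ler_wpM2l ?invr_ge0 ?(ltW p2)//.
  apply: le_trans (cabs_ge_Re _).
  rewrite -[complex.Re _]/(Rintegral mu setT (fun xi => complex.Re
    (cis (- th) * (fourier (packet b l) xi * cis (dot x xi + peval P xi * t))))).
  apply: le_trans (ler_norm _).
  rewrite le_eqVlt; apply/orP; left; apply/eqP; apply: eq_Rintegral => xi _.
  rewrite fourier_packet// [in RHS]mulrCA -cisD complexReM/= mul0r subr0 -[RHS]mulrA.
  by congr (_ * (_ * cos _)); rewrite /ph addrC.
have ig := integrable_gaussn b l0.
have ig2 := integrable_gaussn b l20.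
rewrite RintegralZl//; last exact: integrable_gaussn_cos.
have gE xi : gaussn b l xi * expR ((\sum_(j < n) ((tnth xi j - b j) / l j) ^+ 2) / 2) =
    gaussn b (fun j => Num.sqrt 2 * l j) xi.
  rewrite /gaussn mulr_suml expR_sum -big_split/=; apply: eq_bigr => j _.
  rewrite /gauss -expRD; congr expR.
  rewrite !expr_div_n exprMn sqr_sqrtr//; field; exact: lt0r_neq0.
have h1 : Rintegral mu setT (fun xi => gaussn b l xi -
    kap ^+ 2 / 2 * gaussn b (fun j => Num.sqrt 2 * l j) xi) <=
    Rintegral mu setT (fun xi => gaussn b l xi * cos (ph xi)).
  apply: le_Rintegral => //.
  - exact: (integrableB measurableT ig (integrableZl measurableT (kap ^+ 2 / 2) ig2)).
  - exact: integrable_gaussn_cos.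
  move=> xi _; rewrite -gE.
  apply: (@le_trans _ _ (gaussn b l xi * (1 - ph xi ^+ 2 / 2))); last first.
    by rewrite ler_wpM2l ?gaussn_ge0// cos_ge.
  rewrite mulrBr mulr1 lerD2l lerN2 [leRHS]mulrCA ler_wpM2l ?gaussn_ge0//.
  rewrite [leRHS]mulrAC ler_pM2r ?invr_gt0//.
  have -> : expR ((\sum_(j < n) ((tnth xi j - b j) / l j) ^+ 2) / 2) =
      expR ((\sum_(j < n) ((tnth xi j - b j) / l j) ^+ 2) / 4) ^+ 2.
    by rewrite -expRM_natl; congr expR; field.
  rewrite -exprMn -[leLHS]real_normK ?num_real// lerXn2r ?nnegrE//.
  - by apply: le_trans (hth xi).
  - exact: hth.
have vE (v : 'I_n -> R) : (forall j, 0 < v j) ->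
    Rintegral mu setT (gaussn b v) = \prod_(j < n) (Num.sqrt pi * v j).
  by move=> v0; rewrite /Rintegral integral_gaussn.
rewrite RintegralB// in h1; last first.
  exact: (integrableZl measurableT (kap ^+ 2 / 2) ig2).
rewrite RintegralZl// !vE// in h1.
have pE2 : \prod_(j < n) (Num.sqrt pi * (Num.sqrt 2 * l j)) =
    Num.sqrt 2 ^+ n * \prod_(j < n) (Num.sqrt pi * l j) :> R.
  rewrite -[X in _ ^+ X]card_ord -prodr_const -big_split/=.
  by apply: eq_bigr => j _; rewrite mulrCA.
rewrite pE2 in h1.
have G0 : 0 <= \prod_(j < n) (Num.sqrt pi * l j) :> R.
  by apply: prodr_ge0 => j _; rewrite mulr_ge0 ?sqrtr_ge0 ?(ltW (l0 j)).
rewrite [leRHS]mulrC ler_pdivlMr// -(packet_constM l0) [leLHS]mulrCA ler_wpM2l ?(ltW pc0)//.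
apply: le_trans h1; move: (\prod_(j < n) _) G0 => G G0.
move: (Num.sqrt 2 ^+ n) hkap => q hkap; nra.
Qed.

End evolution_lower_bound.

(** * From pointwise lower bounds on a box to the maximal function *)

Section maximal_function_lower_bound.
Variables (R : realType) (n : nat).
Local Notation mu := (lebesgue_Rn R n).

Lemma box_integral_ge (F : Rn R n -> \bar R) (c u v : R) : u < v -> 0 <= c ->
  measurable_fun (@unit_ball R n) F -> (forall x, 0 <= F x)%E ->
  (forall x, (forall j, u <= tnth x j <= v) -> unit_ball x /\ (c%:E <= F x)%E) ->
  ((c * (v - u) ^+ n)%:E <= \int[mu]_(x in @unit_ball R n) F x)%E.
Proof.
move=> uv c0 mF F0 hF.
pose h (x : Rn R n) := \prod_(j < n) \1_(`[u, v]%classic : set R) (tnth x j : R) : R.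
have mI : measurable_fun setT (\1_(`[u, v]%classic : set R) : R -> R).
  exact: measurable_indic.
have h0 x : 0 <= h x by apply: prodr_ge0.
have mh : measurable_fun setT h.
  exact: (measurable_prod_tnth (h := fun=> \1_(`[u, v]%classic : set R))).
have hE x : h x != 0 -> forall j, u <= tnth x j <= v.
  move=> hx j; apply: contraNT hx => xj.
  by rewrite /h (bigD1 j)//= indicE memNset ?mul0r//= in_itv/=; exact/negP.
have Ih : (\int[mu]_x (h x)%:E = ((v - u) ^+ n)%:E)%E.
  rewrite (integral_prod (h := fun=> \1_(`[u, v]%classic : set R)) (c := fun=> v - u))//.
    by rewrite prodr_const card_ord.
  move=> _; rewrite integral_indic// setIT.
  by have := lebesgue_measure_itv `[u, v]; rewrite /= lte_fin uv -EFinB.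
have -> : ((c * (v - u) ^+ n)%:E = \int[mu]_x (c%:E * (h x)%:E))%E.
  rewrite ge0_integralZl_EFin// ?Ih//; first by move=> x _; rewrite lee_fin.
  exact/measurable_EFinP.
rewrite [leRHS]integral_mkcond; apply: ge0_le_integral => //.
- by move=> x _; rewrite -EFinM lee_fin mulr_ge0.
- by apply: emeasurable_funM => //; exact/measurable_EFinP.
- apply/(measurable_restrictT F) => //; exact: measurable_unit_ball.
move=> x _; have [->|/hE /hF [bx cx]] := eqVneq (h x) 0.
  by rewrite mule0 patchE; case: ifP.
rewrite patchE ifT ?inE// (le_trans _ cx)// -EFinM lee_fin ler_piMr//.
by apply: prodr_ile1 => j _; rewrite indicE; case: (_ \in _); rewrite ?ler01 ?lexx.
Qed.

Lemma maximal_function_ge (g : R -> Rn R n -> R[i]) x t c :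
  0 < t < 1 -> c <= cabs (g t x) -> (c%:E <= maximal_function g x)%E.
Proof.
move=> t01 cg; apply: (@le_trans _ _ (cabs (g t x))%:E); first by rewrite lee_fin.
by apply: ereal_sup_ubound; exists t.
Qed.

Lemma maximal_function_ge0 (g : R -> Rn R n -> R[i]) x : (0 <= maximal_function g x)%E.
Proof.
apply: (@maximal_function_ge _ _ (2^-1)); last exact: cabs_ge0.
by rewrite invr_gt0 ltr0n/= invf_lt1// ltr1n.
Qed.

End maximal_function_lower_bound.

(** * The maximal estimate tested on packets, as the frequency scale tends to infinity *)

Section necessary_condition.
Variables (R : realType) (n : nat) (P : mpoly n R) (i0 : 'I_n) (a : 'I_n -> R).
Variables (q : R) (e p p' : nat).

Definition widths (kap M : R) (j : 'I_n) : R := if j == i0 then M else kap.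

(* The phase of the wave packet at (x, t), with t chosen so that the packet
   passes over x, is constant up to an error of order kap. *)
Definition stationary_phase (A : R) (K : nat) : Prop := forall kap L : R,
  0 < kap <= 1 -> 1 <= L -> forall x xi : Rn R n, (forall j, `|tnth x j : R| <= 1) ->
  let b := [tuple L ^+ p * a j | j < n] : Rn R n in
  let t := - tnth x i0 / ((L ^+ p) ^+ e * q) in
  `|dot x xi + peval P xi * t - (dot x b + peval P b * t)| <=
  A * kap * (\prod_(j < n)
    (1 + `|(tnth xi j - tnth b j) / widths kap (kap * L ^+ p') j|)) ^+ K.

(** Converts the polynomial weight of [stationary_phase] into the exponential one of
    [evolution_packet_ge]; in each coordinate it is the decay of a Gaussian of width 2, whose
    inverse is exp(z^2 / 4). *)
Lemma powS_le_exp K : exists2 D : R, 0 < D & forall z : 'I_n -> R,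
  (\prod_(j < n) (1 + `|z j|)) ^+ K <= D * expR ((\sum_(j < n) z j ^+ 2) / 4).
Proof.
have [|M hM] := @gauss_decay R 2 K; first by [].
have M0 : 0 < M.
  by apply: lt_le_trans (hM 0); rewrite normr0 addr0 expr1n mul1r expR_gt0.
exists (M ^+ n); first exact: exprn_gt0.
move=> z; rewrite -prodrXl mulr_suml expR_sum -[n in M ^+ n]card_ord -prodr_const.
rewrite -big_split/=; apply: ler_prod => j _.
rewrite exprn_ge0 ?addr_ge0//=.
have := hM (z j); rewrite /gauss subr0 -ler_pdivlMr ?expR_gt0// -expRN opprK.
by rewrite expr_div_n -natrX.
Qed.

(** The left side of the estimate stays above a constant, while the squared norm is at most a
    constant times L^(2 p max(s,0)) / L^p'. So L^p' is bounded by a constant times L^(2 p max(s,0))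
    for all large L, which fails when s < p'/(2p). *)
Lemma necessary_condition (A : R) (K : nat) (s C : R) :
  (0 < n)%N -> (0 < e)%N -> (0 < p')%N -> (p' <= p)%N -> q != 0 -> 0 <= A ->
  stationary_phase A K -> maximal_estimate P s C -> p'%:R / (2 * p%:R) <= s.
Proof.
move=> n0 e0 p'0 pp' q0 A0 hA hC; rewrite leNgt; apply/negP => ls.
have p0 : (0 : R) < p%:R by rewrite ltr0n (leq_trans p'0).
pose sg := Num.max s 0.
have sg0 : 0 <= sg by rewrite le_max lexx orbT.
have hsg : 2 * p%:R * sg < p'%:R.
  rewrite mulrC -ltr_pdivlMr ?mulr_gt0// /sg gt_max ls divr_gt0 ?ltr0n// mulr_gt0//.
have s1 : s <= 1.
  apply: (le_trans (ltW ls)); rewrite ler_pdivrMr ?mulr_gt0// mul1r.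
  by rewrite -natrM ler_nat (leq_trans pp')// leq_pmull.
have [D D0 hD] := powS_le_exp K.
pose q2 : R := Num.sqrt 2 ^+ n.
have q21 : 1 <= q2.
  by rewrite exprn_ege1// -[leLHS]sqrtr1 ler_wsqrtr// ler1n.
(* Small enough that [A * kap * D], the final size of the phase error, meets the smallness condition
   of [evolution_packet_ge] ([kapq]). *)
pose kap := (1 + A * D * q2)^-1.
have AD0 : 0 <= A * D by rewrite mulr_ge0// ltW.
have den : 0 < 1 + A * D * q2.
  by rewrite ltr_pwDl// mulr_ge0// (le_trans ler01).
have kap0 : 0 < kap by rewrite invr_gt0.
have kap1 : kap <= 1.
  by rewrite invf_le1// lerDl mulr_ge0// (le_trans ler01).
have kapq : (A * kap * D) ^+ 2 * q2 <= 1.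
  have h1 : A * kap * D * q2 <= 1.
    rewrite (_ : A * kap * D * q2 = A * D * q2 / (1 + A * D * q2)); last by rewrite /kap; ring.
    by rewrite ler_pdivrMr// mul1r lerDr.
  have h0 : 0 <= A * kap * D by rewrite !mulr_ge0// ltW.
  have h2 : A * kap * D <= 1 by apply: le_trans h1; rewrite ler_peMr.
  by rewrite expr2 -mulrA mulr_ile1// mulr_ge0// (le_trans ler01).
(* The cube of half-side [rho] lies in the open unit ball because n rho^2 < 1. *)
pose rho : R := n.+1%:R^-1.
have rho0 : 0 < rho by rewrite invr_gt0 ltr0n.
have rho1 : rho < 1 by rewrite invf_lt1 ?ltr0n// ltr1n.
have nrho : n%:R * rho ^+ 2 < 1.
  rewrite /rho expr2 mulrA; apply: (@le_lt_trans _ _ (1 * rho)); last by rewrite mul1r.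
  by rewrite ler_wpM2r ?(ltW rho0)// ler_pdivrMr ?ltr0n// mul1r ler_nat.
pose c2 : R := 1 / 2 * (rho / 2) ^+ n.
have c20 : 0 < c2 by rewrite mulr_gt0 ?divr_gt0// exprn_gt0// divr_gt0.
(* From xi_j = N a_j + w_j z_j with w_j <= N and (x + y)^2 <= 2 x^2 + 2 y^2; this makes N^2 [ca] an
   admissible B in [sobolev_packet]. *)
pose ca : R := 2 + 2 * \sum_(j < n) a j ^+ 2.
have ca1 : 1 <= ca.
  have : 0 <= \sum_(j < n) a j ^+ 2 by apply: sumr_ge0 => j _; exact: sqr_ge0.
  rewrite /ca; lra.
pose c1 : R := (Num.sqrt pi * 2) ^+ n.
have main (L : R) : 1 <= L -> 1 <= L * `|q| ->
    c2 ^+ 2 * kap ^+ n * L ^+ p' <= C ^+ 2 * (ca `^ sg * c1) * L `^ (2 * p%:R * sg).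
  move=> L1 Lq.
  have L0 : 0 < L by exact: lt_le_trans ltr01 L1.
  pose N := L ^+ p; pose M := kap * L ^+ p'.
  have N1 : 1 <= N by rewrite exprn_ege1.
  have N0 : 0 < N by exact: lt_le_trans ltr01 N1.
  pose w := widths kap M; pose b := [tuple N * a j | j < n] : Rn R n.
  have M0 : 0 < M by rewrite mulr_gt0// exprn_gt0.
  have w0 j : 0 < w j by rewrite /w /widths; case: ifP.
  have wN j : w j <= N.
    rewrite /w /widths; case: ifP => _; last exact: le_trans kap1 N1.
    by rewrite /M -[leRHS]mul1r ler_pM ?exprn_ge0 ?(ltW kap0) ?(ltW L0)// ler_weXn2l.
  pose bf (j : 'I_n) : R := tnth b j.
  have hB (xi : Rn R n) : 1 + enorm xi ^+ 2 <=
      N ^+ 2 * ca * (1 + \sum_(j < n) ((tnth xi j - bf j) / w j) ^+ 2).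
    rewrite /enorm sqr_sqrtr; last by apply: sumr_ge0 => j _; rewrite -expr2 sqr_ge0.
    set S := \sum_(j < n) ((tnth xi j - bf j) / w j) ^+ 2.
    have S0 : 0 <= S by apply: sumr_ge0 => j _; exact: sqr_ge0.
    have h1 : dot xi xi <= 2 * N ^+ 2 * (\sum_(j < n) a j ^+ 2 + S).
      rewrite /S -big_split/= mulr_sumr; apply: ler_sum => j _.
      rewrite /bf tnth_mktuple.
      have w1 := w0 j; have w2 := wN j.
      set z := (tnth xi j - N * a j) / w j.
      have hz : tnth xi j = N * a j + w j * z by rewrite /z; field; exact: lt0r_neq0.
      clearbody z; rewrite hz.
      have h : (w j * z) ^+ 2 <= N ^+ 2 * z ^+ 2.
        by rewrite exprMn ler_wpM2r ?sqr_ge0// lerXn2r ?nnegrE// ltW.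
      have hx : (N * a j) ^+ 2 = N ^+ 2 * a j ^+ 2 by rewrite exprMn.
      have := sqr_ge0 (N * a j - w j * z); move: h hx.
      move: (w j * z) (N * a j) => y x h hx hs.
      have -> : (x + y) * (x + y) = 2 * (x ^+ 2 + y ^+ 2) - (x - y) ^+ 2 by ring.
      by rewrite hx mulrDr; lra.
    have N2 : 1 <= N ^+ 2 by rewrite exprn_ege1.
    rewrite /ca; have : 0 <= \sum_(j < n) a j ^+ 2 by apply: sumr_ge0 => j _; exact: sqr_ge0.
    move: (\sum_(j < n) a j ^+ 2) h1 => T h1 T0.
    apply: (le_trans (lerD (lexx 1) h1)); move: (N ^+ 2) N2 => N2 N21.
    have : 0 <= N2 * (T * S) by rewrite !mulr_ge0// (le_trans ler01).
    have : 0 <= N2 * S by rewrite mulr_ge0// (le_trans ler01).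
    by move=> u1 u2; lra.
  have [||r [hr r0 rB]] := sobolev_packet w0 s1 _ hB.
  - by rewrite mulr_gt0 ?exprn_gt0// (lt_le_trans ltr01).
  - by rewrite -[leLHS]mulr1 ler_pM// exprn_ege1.
  have [g [hg mg Ig]] := hC _ _ hr.
  (* The sign of every coordinate is opposite to that of q, so t > 0 for the time of stationary
     phase; [Nq] gives t <= [rho] < 1. *)
  pose u := if 0 < q then - rho else rho / 2.
  pose v := if 0 < q then - (rho / 2) else rho.
  have vu : v - u = rho / 2 by rewrite /u /v; case: ifP => _; lra.
  have uv : u < v by rewrite -subr_gt0 vu divr_gt0.
  have Nq : 1 <= N ^+ e * `|q|.
    apply: (le_trans Lq); rewrite ler_wpM2r// /N -exprM -[leLHS]expr1.
    by rewrite ler_weXn2l// muln_gt0 e0 (leq_trans p'0).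
  have bx (x : Rn R n) : (forall j, u <= tnth x j <= v) ->
      unit_ball x /\ (((1 / 2)%:E) <= maximal_function g x)%E.
    move=> xuv.
    have xr j : `|tnth x j : R| <= rho.
      have := xuv j; rewrite /u /v; case: ifP => _ /andP[h1 h2].
        by rewrite ler_norml; lra.
      by rewrite ler_norml; lra.
    have ux : unit_ball x.
      rewrite /unit_ball/= /enorm -[ltRHS]sqrtr1 ltr_sqrt//.
      apply: le_lt_trans nrho; rewrite -[n in n%:R]card_ord -sum1_card natr_sum mulr_suml.
      apply: ler_sum => j _; rewrite mul1r -expr2 -real_normK ?num_real//.
      by rewrite lerXn2r ?nnegrE ?(ltW rho0).
    split => //.
    pose t := - tnth x i0 / (N ^+ e * q).
    have t01 : 0 < t < 1.
      have Ne0 : 0 < N ^+ e by exact: exprn_gt0.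
      have := xuv i0; rewrite /t /u /v; move: (tnth x i0 : R) => y.
      move: Nq; case: ltP => qs Nq.
        rewrite gtr0_norm// in Nq.
        move=> /andP[h1 h2]; rewrite divr_gt0 ?mulr_gt0//=; last by lra.
        by rewrite ltr_pdivrMr ?mulr_gt0//; lra.
      have qn : q < 0 by rewrite lt_neqAle q0.
      rewrite ltr0_norm// mulrN in Nq.
      move=> /andP[h1 h2]; rewrite -mulrNN -invrN divr_gt0 ?opprK//=; [|lra|lra].
      by rewrite ltr_pdivrMr; lra.
    apply: (maximal_function_ge t01); have [_ hev] := hg _ t01.
    (* The packet being Schwartz, the chosen representative is given at every point of the ball by
       the oscillatory integral. *)
    rewrite (hev (packet bf w)) //; first last.
    - exact: is_function_fun_dist (schwartz_packet _ w0).
    - exact: schwartz_packet.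
    apply: (evolution_packet_ge w0 (th := dot x b + peval P b * t) _ kapq) => xi.
    apply: (le_trans (hA kap L _ L1 x xi _)).
    - by rewrite kap0.
    - by move=> j; exact: le_trans (xr j) (ltW rho1).
    rewrite -[leRHS]mulrA ler_wpM2l ?mulr_ge0 ?(ltW kap0)//.
  have h12 : (0 : R) <= 1 / 2 by rewrite divr_ge0.
  have := box_integral_ge uv h12 mg (maximal_function_ge0 g) bx.
  move=> /le_trans /(_ Ig); rewrite lee_fin vu -/c2 => c2r.
  have c2r2 : c2 ^+ 2 <= C ^+ 2 * r ^+ 2.
    by rewrite -exprMn lerXn2r ?nnegrE ?(ltW c20)// (le_trans _ c2r)// ltW.
  (* The product of the widths is kap^n L^p': one direction of width kap L^p' and n - 1 of width
     kap. Multiplying by it turns the norm bound into a comparison of powers of L. *)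
  have pcE : packet_const w * (kap ^+ n * L ^+ p') = c1.
    have -> : kap ^+ n * L ^+ p' = \prod_(j < n) w j.
      rewrite (bigD1 i0)//= {1}/w /widths eqxx.
      rewrite (eq_bigr (fun=> kap)); last by move=> j /negPf ji; rewrite /w /widths ji.
      rewrite prodr_const (_ : #|_| = n.-1); last first.
        by rewrite cardC1 card_ord.
      by rewrite /M mulrAC -exprS prednK.
    rewrite /packet_const -big_split/= /c1 -[n in RHS]card_ord -prodr_const.
    by apply: eq_bigr => j _; field; exact: lt0r_neq0.
  have pc0 : 0 < packet_const w by exact: packet_const_gt0.
  have kL : 0 < kap ^+ n * L ^+ p' by rewrite mulr_gt0 ?exprn_gt0.
  have BE : (N ^+ 2 * ca) `^ sg = ca `^ sg * L `^ (2 * p%:R * sg).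
    rewrite powRM ?exprn_ge0 ?(ltW L0)//; last exact: le_trans ler01 ca1.
    rewrite mulrC; congr (_ * _); rewrite powRrM; congr (_ `^ _).
    by rewrite -natrM powR_mulrn ?(ltW L0)// /N -exprM mulnC.
  rewrite -mulrA.
  apply: (le_trans (ler_wpM2r (ltW kL) c2r2)).
  rewrite -[leLHS]mulrA -[leRHS]mulrA ler_wpM2l ?sqr_ge0//.
  apply: (le_trans (ler_wpM2r (ltW kL) rB)).
  by rewrite -[leLHS]mulrA pcE BE mulrAC.
pose C3 := C ^+ 2 * (ca `^ sg * c1) / (c2 ^+ 2 * kap ^+ n).
pose del := p'%:R - 2 * p%:R * sg.
have del0 : 0 < del by rewrite subr_gt0.
have C30 : 0 <= C3.
  have c10 : 0 <= c1 by rewrite exprn_ge0// mulr_ge0// sqrtr_ge0.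
  apply: divr_ge0; last by rewrite mulr_ge0 ?sqr_ge0// exprn_ge0// ltW.
  by rewrite mulr_ge0 ?sqr_ge0// mulr_ge0// powR_ge0.
(* The first entry secures [L * |q| >= 1], the second [L] to the power [del] at least [C3 + 1],
   whereas [main] forces that power to be at most [C3]. *)
pose L := Num.max (1 + `|q|^-1) ((C3 + 1) `^ del^-1).
have L1 : 1 <= L by rewrite /L le_max lerDl invr_ge0 normr_ge0.
have L0 : 0 < L by exact: lt_le_trans ltr01 L1.
have Lq : 1 <= L * `|q|.
  rewrite -ler_pdivrMr ?normr_gt0// /L le_max; apply/orP; left; rewrite mul1r lerDr//.
have LC : C3 + 1 <= L `^ del.
  have h : (C3 + 1) `^ del^-1 <= L by rewrite /L le_max lexx orbT.
  have -> : C3 + 1 = ((C3 + 1) `^ del^-1) `^ del.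
    by rewrite -powRrM mulVf ?lt0r_neq0// powRr1 ?addr_ge0.
  apply: ge0_ler_powR => //; first exact: ltW.
  - by rewrite nnegrE powR_ge0.
  - by rewrite nnegrE ltW.
have := main L L1 Lq.
rewrite -[L ^+ p']powR_mulrn ?(ltW L0)//.
have -> : p'%:R = del + 2 * p%:R * sg by rewrite /del subrK.
rewrite powRD; last by rewrite (gt_eqF L0) implybT.
rewrite mulrA ler_pM2r ?powR_gt0// mulrC -ler_pdivlMr; last first.
  by rewrite mulr_gt0 ?exprn_gt0.
move=> h; have := le_trans LC h; rewrite -/C3; lra.
Qed.

End necessary_condition.

(** * Size, variation and non-vanishing of polynomials *)

Section polynomial_estimates.
Variables (R : realType) (n : nat).
Implicit Types (p : mpoly n R) (u v : 'I_n -> R).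

Lemma meval_eq_in (A : {set 'I_n}) p u v : poly_in A p ->
  (forall j, j \in A -> u j = v j) -> meval u p = meval v p.
Proof.
move=> pA uv; rewrite !mpoly.mevalE big_seq [RHS]big_seq.
apply: eq_bigr => m mp; congr (_ * _); apply: eq_bigr => j _.
have [->|mj] := eqVneq (m j) 0%N; first by rewrite !expr0.
by rewrite uv// (pA m mp).
Qed.

Lemma meval_form e p c v : is_form e p ->
  meval (fun j => c * v j) p = c ^+ e * meval v p.
Proof.
move=> /mpoly.dhomogP pe; rewrite !mpoly.mevalE mulr_sumr big_seq [RHS]big_seq.
apply: eq_bigr => m mp; rewrite mulrCA; congr (_ * _).
under eq_bigr do rewrite exprMn.
have em : mdeg m = e := pe m mp.
rewrite big_split/= -em mpoly.mdegE; congr (_ * _).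
by rewrite prodrXr.
Qed.

Definition degree_le D p : Prop :=
  forall m : multinom n, m \in msupp p -> (mdeg m <= D)%N.

Lemma is_form_degree_le e p : is_form e p -> degree_le e p.
Proof. by move=> /mpoly.dhomogP pe m /pe ->. Qed.

Lemma meval_bound D p : degree_le D p ->
  exists2 C : R, 0 <= C & forall (Y : R) v, 1 <= Y -> (forall j, `|v j| <= Y) ->
    `|meval v p| <= C * Y ^+ D.
Proof.
move=> pD; exists (\sum_(m <- msupp p) `|mcoeff m p|); first exact: sumr_ge0.
move=> Y v Y1 vY; rewrite mpoly.mevalE mulr_suml (le_trans (ler_norm_sum _ _ _))//.
rewrite big_seq [leRHS]big_seq; apply: ler_sum => m mp.
rewrite normrM ler_wpM2l// normr_prod.
apply: (@le_trans _ _ (Y ^+ mdeg m)); last by rewrite ler_weXn2l ?pD.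
rewrite mpoly.mdegE -prodrXr; apply: ler_prod => j _.
by rewrite normrX exprn_ge0//= lerXn2r ?nnegrE// (le_trans ler01).
Qed.

(** The mean value bound m Y^(m-1) h, multiplied through by Y so that the exponent m - 1 does not
    appear and m = 0 is no exception. *)
Lemma expr_diff_bound (Y h x y : R) m : 0 <= Y -> `|x| <= Y -> `|y| <= Y ->
  `|x - y| <= h -> Y * `|x ^+ m - y ^+ m| <= m%:R * Y ^+ m * h.
Proof.
move=> Y0 xY yY xyh; have h0 : 0 <= h by exact: le_trans xyh.
elim: m => [|m IH]; first by rewrite subrr normr0 mulr0 !mul0r.
have -> : x ^+ m.+1 - y ^+ m.+1 = x * (x ^+ m - y ^+ m) + (x - y) * y ^+ m.
  by rewrite !exprS; ring.
apply: (@le_trans _ _ (Y * (Y * `|x ^+ m - y ^+ m| + h * Y ^+ m))).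
  rewrite ler_wpM2l// (le_trans (ler_normD _ _))// !normrM lerD//.
    by rewrite ler_wpM2r.
  by rewrite ler_pM// normrX lerXn2r ?nnegrE.
rewrite -natr1 exprS mulrDr.
have : 0 <= Y ^+ m by rewrite exprn_ge0.
have := ler_wpM2l Y0 IH.
move: (Y * `|_|) (Y ^+ m) => T Z hT Z0; lra.
Qed.

Lemma meval_diff_bound D p : degree_le D p ->
  exists2 C : R, 0 <= C & forall (Y h : R) u v, 1 <= Y -> 0 <= h ->
    (forall j, `|u j| <= Y) -> (forall j, `|v j| <= Y) ->
    (forall j, `|u j - v j| <= h) ->
    Y * `|meval u p - meval v p| <= C * Y ^+ D * h.
Proof.
move=> pD; exists (\sum_(m <- msupp p) `|mcoeff m p| * D%:R).
  by apply: sumr_ge0 => m _; rewrite mulr_ge0.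
move=> Y h u v Y1 h0 uY vY uvh; have Y0 : 0 <= Y by exact: le_trans ler01 Y1.
rewrite !mpoly.mevalE -sumrB -mulrA mulr_suml.
apply: (@le_trans _ _ (Y * \sum_(m <- msupp p)
    `|mcoeff m p * \prod_i u i ^+ m i - mcoeff m p * \prod_i v i ^+ m i|)).
  by rewrite ler_wpM2l// ler_norm_sum.
rewrite mulr_sumr big_seq [leRHS]big_seq; apply: ler_sum => m mp.
rewrite -mulrBr normrM mulrCA -mulrA ler_wpM2l//.
apply: (@le_trans _ _ ((mdeg m)%:R * Y ^+ mdeg m * h)); last first.
  rewrite -mulrA ler_pM ?ler_nat ?pD ?mulr_ge0 ?exprn_ge0//.
  by rewrite ler_wpM2r// ler_weXn2l// pD.
(* Carried through the product one variable at a time: telescoping the difference needs the sizes of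
   both partial products as well. *)
pose Q (x y : R) (s : nat) := [/\ `|x| <= Y ^+ s, `|y| <= Y ^+ s &
   Y * `|x - y| <= s%:R * Y ^+ s * h].
suff [_ _ //] : Q (\prod_i u i ^+ m i) (\prod_i v i ^+ m i) (mdeg m).
rewrite mpoly.mdegE; apply: (big_rec3 Q) => [|j y x s _ [ys xs xys]]; rewrite /Q.
  by rewrite !expr0 !normr1 lexx subrr normr0 mulr0 !mul0r.
have uj : `|u j ^+ m j| <= Y ^+ m j by rewrite normrX lerXn2r ?nnegrE.
have vj : `|v j ^+ m j| <= Y ^+ m j by rewrite normrX lerXn2r ?nnegrE.
split.
- by rewrite normrM exprD ler_pM.
- by rewrite normrM exprD ler_pM.
have -> : u j ^+ m j * y - v j ^+ m j * x =
   u j ^+ m j * (y - x) + (u j ^+ m j - v j ^+ m j) * x by ring.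
have d1 := expr_diff_bound (m j) Y0 (uY j) (vY j) (uvh j).
apply: (@le_trans _ _ (Y ^+ m j * (Y * `|y - x|) + (Y * `|u j ^+ m j - v j ^+ m j|) * Y ^+ s)).
  rewrite [leRHS](_ : _ = Y * (Y ^+ m j * `|y - x| +
    `|u j ^+ m j - v j ^+ m j| * Y ^+ s)); last by ring.
  rewrite ler_wpM2l// (le_trans (ler_normD _ _))// !normrM lerD//.
    by rewrite ler_wpM2r.
  by rewrite ler_wpM2l.
have Ym : 0 <= Y ^+ m j by rewrite exprn_ge0.
have Ys : 0 <= Y ^+ s by rewrite exprn_ge0.
apply: (le_trans (lerD (ler_wpM2l Ym xys) (ler_wpM2r Ys d1))).
by rewrite exprD natrD le_eqVlt; apply/orP; left; apply/eqP; ring.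
Qed.

(** Uniqueness of base-[D] digits: reduction modulo [D] isolates the lowest one, and division by [D]
    gives the induction. *)
Lemma kronecker_inj (D : nat) k (f g : 'I_k -> nat) :
  (forall j, f j < D)%N -> (forall j, g j < D)%N ->
  (\sum_(j < k) f j * D ^ j = \sum_(j < k) g j * D ^ j)%N -> forall j, f j = g j.
Proof.
elim: k f g => [|k IH] f g fD gD; first by move=> _ [].
rewrite !big_ord_recl/= !expn0 !muln1.
have E (h : 'I_k.+1 -> nat) : (\sum_(i < k) h (lift ord0 i) * D ^ bump 0 i =
    (\sum_(i < k) h (lift ord0 i) * D ^ i) * D)%N.
  by rewrite big_distrl/=; apply: eq_bigr => j _; rewrite /bump add1n expnSr mulnA.
rewrite !E => e.
have e0 : f ord0 = g ord0.
  have := congr1 (modn^~ D) e; rewrite /= addnC modnMDl modn_small// => ->.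
  by rewrite addnC modnMDl modn_small.
have eS : (\sum_(i < k) f (lift ord0 i) * D ^ i =
    \sum_(i < k) g (lift ord0 i) * D ^ i)%N.
  move: e; rewrite e0 => /addnI /eqP; rewrite eqn_pmul2r; first by move/eqP.
  exact: leq_ltn_trans (fD ord0).
move=> j; case: (unliftP ord0 j) => [j'|] -> //.
exact: (IH (fun i => f (lift ord0 i)) (fun i => g (lift ord0 i))).
Qed.

(* Kronecker substitution x_j = t^(D^j) reduces to one variable. *)
Lemma meval_neq0 (A : {set 'I_n}) p (m0 : multinom n) :
  m0 \in msupp p -> monomial_in A m0 ->
  exists2 v : 'I_n -> R, (forall j, j \notin A -> v j = 0) & meval v p != 0.
Proof.
move=> m0p m0A.
pose D := msize p.
pose w (m : multinom n) := (\sum_(j < n) m j * D ^ j)%N.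
pose inA (m : multinom n) := [forall j, (m j != 0%N) ==> (j \in A)].
pose U : {poly R} := \sum_(m <- msupp p | inA m) mcoeff m p *: 'X^(w m).
have inAP (m : multinom n) : inA m -> monomial_in A m.
  by move=> /forallP h j mj; have := h j; rewrite mj.
have wI m m' : m \in msupp p -> m' \in msupp p -> w m = w m' -> m = m'.
  move=> mp mp' e; apply/mpoly.mnmP.
  have lt (m1 : multinom n) (j : 'I_n) : m1 \in msupp p -> (m1 j < D)%N.
    move=> /mpoly.msize_mdeg_lt; apply: leq_ltn_trans.
    by rewrite mpoly.mdegE (bigD1 j)//= leq_addr.
  exact: (@kronecker_inj D n m m' (fun j => lt m j mp) (fun j => lt m' j mp') e).
have U0 : U != 0.
  apply/eqP => /(congr1 (fun r : {poly R} => r`_(w m0))).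
  have m0I : inA m0 by apply/forallP => j; apply/implyP; exact: m0A.
  rewrite coef_sum coef0 big_mkcond (bigD1_seq m0) ?mpoly.msupp_uniq//= m0I.
  rewrite coefZ coefXn eqxx mulr1 big_seq_cond big1 => [|m /andP[mp mm0]].
    by move/eqP; rewrite addr0 mpoly.mcoeff_eq0 m0p.
  case: ifP => // _; rewrite coefZ coefXn.
  case: eqP => [e|_]; last by rewrite mulr0.
  by move: mm0; rewrite (wI _ _ m0p mp e) eqxx.
(* A nonzero polynomial has fewer roots than its size, so some integer among 0, ..., size U - 1 is
   not a root. *)
have [t Ut] : exists t, U.[t] != 0.
  apply: contrapT => /forallNP h.
  pose rs : seq R := [seq i%:R | i <- iota 0 (size U)].
  have /(max_poly_roots U0) : all (root U) rs.
    by apply/allP => r _; apply/rootP/eqP; have /negP := h r; rewrite negbK.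
  rewrite size_map size_iota ltnn => F; suff: false by []; apply: F.
  by rewrite map_inj_uniq ?iota_uniq// => i j /eqP; rewrite eqr_nat => /eqP.
(* Zeros outside [A] kill the monomials that leave [A], so the value of [p] is exactly U(t);
   distinct monomials within [A] keep distinct exponents by [wI]. *)
exists (fun j : 'I_n => if j \in A then t ^+ (D ^ j) else 0).
  by move=> j /negPf ->.
rewrite mpoly.mevalE; move: Ut; rewrite /U horner_sum.
rewrite [X in X != 0 -> _]big_mkcond/=.
congr (_ != 0); apply: eq_bigr => m _.
case: ifP => [mA|/negbT].
  rewrite hornerZ hornerXn; congr (_ * _); rewrite /w -prodrXr.
  apply: eq_bigr => j _; have [->|mj] := eqVneq (m j) 0%N; first by rewrite !expr0.
  by rewrite (inAP m mA j mj) -exprM mulnC.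
rewrite negb_forall => /existsP[j]; rewrite negb_imply => /andP[mj /negPf jA].
by rewrite (bigD1 j)//= jA expr0n (negPf mj) mul0r mulr0.
Qed.

End polynomial_estimates.

Lemma exponent_split d i e : (0 < d)%N -> (d <= i)%N -> (i <= e.+1)%N ->
  (d.-1 + (i - d + (e.+1 - i)) = e)%N.
Proof. by lia. Qed.

(** * Term-by-term bounds on the phase error *)

Section stationary_phase_proof.
Variables (R : realType) (n e : nat) (P : mpoly n R) (Q : nat -> mpoly n R).
Variables (i0 : 'I_n) (a : 'I_n -> R) (d : nat) (Sigma : {set 'I_n}) (hz : Prop).
Local Notation k := e.+1.
Hypothesis hP : msize P = k.+1.
Hypothesis hQ : forall i : nat, (i <= k)%N ->
  is_form (k - i) (Q (k - i)%N) /\ poly_in [set~ i0] (Q (k - i)%N).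
Hypothesis hlead :
  leading_form P = \sum_(0 <= i < k.+1) var R i0 ^+ i * Q (k - i)%N.
Hypotheses (hd2 : (2 <= d)%N) (hdk : (d <= k)%N).
Hypothesis hQS : forall i : nat, (2 <= i)%N -> (i <= d.-1)%N ->
  poly_in Sigma (Q (k - i)%N).
Hypothesis hQ0 : hz -> forall i : nat, (d <= i)%N -> (i <= k)%N -> Q (k - i)%N = 0.
Hypothesis ha0 : a i0 = 0.
Hypothesis haS : forall j, j \in Sigma -> a j = 0.
Hypothesis i0S : i0 \notin Sigma.

Definition scaled (N : R) (j : 'I_n) : R := N * a j.

(** [W] measures the distance from the centre in units of the widths. The proposition [hz] treats
    the two cases of the theorem at once: where it holds the Q_{k-i} with i >= d vanish and M <= kap
    N suffices, otherwise M^d <= kap N^(d-1) is required. *)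
Definition near_packet (kap N M W : R) (xi : 'I_n -> R) : Prop :=
  [/\ 0 < kap <= 1, 1 <= N, 0 <= M <= kap * N & hz \/ M ^+ d <= kap * N ^+ d.-1] /\
  [/\ 1 <= W, `|xi i0| <= M * W & forall j, j != i0 -> `|xi j - N * a j| <= kap * W].

(** An error is acceptable at size kap N^e because the time t is of order 1 / (N^e q). The exponent
    e + 2 = k + 1 of [W] is large enough for all terms of [P]. *)
Definition phase_error (T : R -> ('I_n -> R) -> R) : Prop :=
  exists2 A : R, 0 <= A & forall kap N M W xi, near_packet kap N M W xi ->
    `|T N xi| <= A * (kap * N ^+ e) * W ^+ e.+2.

Lemma phase_errorD T1 T2 : phase_error T1 -> phase_error T2 ->
  phase_error (fun N xi => T1 N xi + T2 N xi).
Proof.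
move=> [A1 A10 h1] [A2 A20 h2]; exists (A1 + A2); first exact: addr_ge0.
move=> kap N M W xi ad; rewrite !mulrDl (le_trans (ler_normD _ _))//.
by apply: lerD; [exact: h1 ad|exact: h2 ad].
Qed.

Lemma phase_error_sum (r : seq nat) (T : nat -> R -> ('I_n -> R) -> R) :
  (forall i, i \in r -> phase_error (T i)) ->
  phase_error (fun N xi => \sum_(i <- r) T i N xi).
Proof.
elim: r => [|i r IH] hT.
  exists 0 => // kap N M W xi _.
  by rewrite big_nil normr0 !mul0r.
have h1 : phase_error (T i) by apply: hT; rewrite mem_head.
have h2 : phase_error (fun N xi => \sum_(i <- r) T i N xi).
  by apply: IH => j jr; apply: hT; rewrite in_cons jr orbT.
have [A A0 hA] := phase_errorD h1 h2; exists A => // kap N M W xi ad.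
by rewrite big_cons; exact: hA ad.
Qed.

Let Am : R := 1 + \sum_(j < n) `|a j|.

Let Am1 : 1 <= Am. Proof. by rewrite lerDl sumr_ge0. Qed.

Lemma near_packet_bounds kap N M W xi : near_packet kap N M W xi ->
  [/\ 1 <= N * Am * W, forall j, `|xi j| <= N * Am * W,
      forall j, `|scaled N j| <= N * Am * W,
      forall j, `|xi j - scaled N j| <= kap * N * W &
      (0 <= kap * N * W) && (0 <= kap * W)].
Proof.
move=> [[/andP[k0 k1] N1 /andP[M0 MN] _] [W1 x0 xj]].
have N0 : 0 < N by exact: lt_le_trans N1.
have W0 : 0 < W by exact: lt_le_trans W1.
have A0 : 0 < Am by exact: lt_le_trans Am1.
have aj j : 1 + `|a j| <= Am.
  by rewrite lerD2l (bigD1 j)//= lerDl sumr_ge0.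
have hd j : `|xi j - scaled N j| <= kap * N * W.
  have [->|ji] := eqVneq j i0.
    by rewrite /scaled ha0 mulr0 subr0 (le_trans x0)// ler_wpM2r// ltW.
  apply: (le_trans (xj j ji)); rewrite ler_wpM2r ?(ltW W0)//.
  by rewrite ler_peMr// ltW.
have hN j : `|scaled N j| <= N * `|a j| by rewrite normrM gtr0_norm.
have NW : N <= N * W by rewrite ler_peMr// ltW.
have NW0 : 0 < N * W by rewrite mulr_gt0.
split => //.
- by rewrite -[leLHS]mulr1 ler_pM// -[leLHS]mulr1 ler_pM.
- move=> j; have -> : xi j = scaled N j + (xi j - scaled N j) by ring.
  apply: (le_trans (ler_normD _ _)).
  have h1 := hN j; have h2 := hd j; have h3 := aj j.
  have h4 : kap * N * W <= N * W by rewrite -mulrA ler_piMl// ltW.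
  have h5 : N * W * (1 + `|a j|) <= N * W * Am by rewrite ler_wpM2l// ltW.
  have h6 : N * `|a j| <= N * W * `|a j| by rewrite ler_wpM2r.
  rewrite mulrAC; lra.
- move=> j; apply: (le_trans (hN j)).
  have h3 := aj j.
  have h5 : N * W * (1 + `|a j|) <= N * W * Am by rewrite ler_wpM2l// ltW.
  have h6 : N * `|a j| <= N * W * `|a j| by rewrite ler_wpM2r.
  rewrite mulrAC; lra.
by rewrite !mulr_ge0 ?ltW.
Qed.

(** Differencing lowers the degree to e - 1, and a displacement is at most kap N W, even in the
    first direction since M <= kap N; the product is of order kap N^e. *)
Lemma phase_error_low p : degree_le e p ->
  phase_error (fun N xi => meval xi p - meval (scaled N) p).
Proof.
move=> pe; have [C C0 hC] := meval_diff_bound pe.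
exists (C * Am ^+ e); first by rewrite mulr_ge0// exprn_ge0// (le_trans ler01).
move=> kap N M W xi ad.
have [Y1 hx hb hd /andP[h0 _]] := near_packet_bounds ad.
have := hC _ _ _ _ Y1 h0 hx hb hd.
move: ad => [[/andP[k0 k1] N1 _ _] [W1 _ _]].
have N0 : 0 < N by exact: lt_le_trans N1.
have W0 : 0 < W by exact: lt_le_trans W1.
have A0 : 0 < Am by exact: lt_le_trans Am1.
move=> h.
have {}h : N * `|meval xi p - meval (scaled N) p| <= C * (N * Am * W) ^+ e * (kap * N * W).
  apply: le_trans h; rewrite ler_wpM2r// -mulrA ler_peMr ?(ltW N0)//.
  by rewrite -[leLHS]mulr1 ler_pM.
rewrite -(ler_pM2l N0); apply: (le_trans h).
rewrite [leRHS](_ : _ = C * (N * Am * W) ^+ e * (kap * N * W) * W); last first.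
  by rewrite !exprMn !exprS; ring.
by rewrite ler_peMr// !mulr_ge0// ?exprn_ge0 ?mulr_ge0// ltW.
Qed.

(* The polynomial does not involve the first variable, so only the small
   displacements of the other coordinates matter. *)
Lemma diff_bound_slow D p : degree_le D p -> poly_in [set~ i0] p ->
  exists2 C : R, 0 <= C & forall kap N M W xi, near_packet kap N M W xi ->
    N * `|meval xi p - meval (scaled N) p| <= C * N ^+ D * kap * W ^+ D.+1.
Proof.
move=> pD pi; have [C C0 hC] := meval_diff_bound pD.
exists (C * Am ^+ D); first by rewrite mulr_ge0// exprn_ge0// (le_trans ler01).
move=> kap N M W xi ad.
(* Resetting the first coordinate to that of the centre, which is 0, reduces the largest
   displacement from M W to kap W. *)
pose xi' j := if j == i0 then 0 else xi j.
have -> : meval xi p = meval xi' p.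
  apply: (meval_eq_in pi) => j; rewrite in_setC1 => /negPf ji.
  by rewrite /xi' ji.
have [Y1 hx hb _ /andP[_ h0]] := near_packet_bounds ad.
have Y0 : 0 <= N * Am * W by exact: le_trans Y1.
have hx' j : `|xi' j| <= N * Am * W by rewrite /xi'; case: ifP; rewrite ?normr0.
have hd' j : `|xi' j - scaled N j| <= kap * W.
  rewrite /xi'; case: eqP => [->|/eqP ji].
    by rewrite /scaled ha0 mulr0 subr0 normr0.
  by have [_ [_ _]] := ad; apply.
have := hC _ _ _ _ Y1 h0 hx' hb hd'.
move: ad => [[/andP[k0 k1] N1 _ _] [W1 _ _]].
have N0 : 0 < N by exact: lt_le_trans N1.
move=> h.
apply: (@le_trans _ _ (N * Am * W * `|meval xi' p - meval (scaled N) p|)).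
  by rewrite ler_wpM2r// -mulrA ler_peMr ?(ltW N0)// -[leLHS]mulr1 ler_pM.
apply: (le_trans h); rewrite le_eqVlt; apply/orP; left; apply/eqP.
by rewrite !exprMn !exprS; ring.
Qed.

(** Here the degree is one too high for [phase_error_low], but the displacement is kap W instead of
    kap N W, which restores the balance. *)
Lemma phase_error_Qk : phase_error (fun N xi => meval xi (Q k) - meval (scaled N) (Q k)).
Proof.
have [/is_form_degree_le qf qi] := hQ (leq0n k); rewrite subn0 in qf qi.
have [C C0 hC] := diff_bound_slow qf qi; exists C => // kap N M W xi ad.
have := hC _ _ _ _ _ ad.
move: ad => [[/andP[k0 k1] N1 _ _] [W1 _ _]].
have N0 : 0 < N by exact: lt_le_trans N1.
move=> h; rewrite -(ler_pM2l N0); apply: (le_trans h).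
by rewrite [N ^+ k]exprS le_eqVlt; apply/orP; left; apply/eqP; ring.
Qed.

(** The factor xi_1, at most N W, makes up for the lower degree of Q_{k-1}. Only the variation of
    Q_{k-1} is an error; its value at the centre produces the term meant to cancel x_1 xi_1. *)
Lemma phase_error_Q1 :
  phase_error (fun N xi => xi i0 * (meval xi (Q e) - meval (scaled N) (Q e))).
Proof.
have [/is_form_degree_le qf qi] := hQ (ltn0Sn e); rewrite subSS subn0 in qf qi.
have [C C0 hC] := diff_bound_slow qf qi; exists C => // kap N M W xi ad.
have := hC _ _ _ _ _ ad.
move: ad => [[/andP[k0 k1] N1 /andP[M0 MN] _] [W1 x0 _]].
have N0 : 0 < N by exact: lt_le_trans N1.
have W0 : 0 < W by exact: lt_le_trans W1.
move=> h; rewrite normrM.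
have x0' : `|xi i0| <= N * W.
  apply: (le_trans x0); rewrite ler_wpM2r ?(ltW W0)// (le_trans MN)//.
  by rewrite ler_piMl// ltW.
apply: (@le_trans _ _ (W * (N * `|meval xi (Q e) - meval (scaled N) (Q e)|))).
  by rewrite mulrA [W * N]mulrC ler_wpM2r.
apply: (le_trans (ler_wpM2l (ltW W0) h)).
by rewrite [W ^+ e.+2]exprS le_eqVlt; apply/orP; left; apply/eqP; ring.
Qed.

(** For i < d, Q_{k-i} is bounded by a power of W and M^i <= (kap N)^i <= kap N^e, as 1 <= i <= e.
    For i >= d without vanishing, M^d <= kap N^(d-1) and M <= N give M^i N^(k-i) <= kap N^(d-1)
    N^(i-d) N^(k-i) = kap N^e. *)
Lemma phase_error_Qi i : (2 <= i)%N -> (i <= k)%N ->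
  phase_error (fun N xi => xi i0 ^+ i * meval xi (Q (k - i)%N)).
Proof.
move=> i2 ik; have [/is_form_degree_le qf qi] := hQ ik.
have [C C0 hC] := meval_bound qf.
have Wk (W : R) : 1 <= W -> W ^+ i * W ^+ (k - i) <= W ^+ e.+2.
  by move=> W1; rewrite -exprD subnKC// ler_weXn2l.
have [id|di] := ltnP i d.
  exists C => // kap N M W xi ad.
  have [_ _ _ _ /andP[_ h0]] := near_packet_bounds ad.
  move: ad => [[/andP[k0 k1] N1 /andP[M0 MN] _] [W1 x0 xj]].
  have N0 : 0 < N by exact: lt_le_trans N1.
  have W0 : 0 < W by exact: lt_le_trans W1.
  (* [Q (k - i)] sees only the variables of [Sigma], where the centre vanishes, so its argument is
     bounded by [W] with no power of [N]. *)
  pose xi' j := if j \in Sigma then xi j else 0.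
  have id1 : (i <= d.-1)%N by rewrite -ltnS prednK// (leq_trans _ hd2).
  have -> : meval xi (Q (k - i)%N) = meval xi' (Q (k - i)%N).
    by apply: (meval_eq_in (hQS i2 id1)) => j jS; rewrite /xi' jS.
  have hx' j : `|xi' j| <= W.
    rewrite /xi'; case: ifP => jS; last by rewrite normr0 ltW.
    have ji : j != i0 by apply: contraTneq jS => ->.
    have := xj j ji; rewrite haS// mulr0 subr0 => /le_trans; apply.
    by rewrite ler_piMl// ltW.
  have hQ' := hC W xi' W1 hx'.
  rewrite normrM normrX.
  have hMi : M ^+ i <= kap * N ^+ e.
    apply: (@le_trans _ _ ((kap * N) ^+ i)).
      by rewrite lerXn2r ?nnegrE// mulr_ge0// ltW.
    rewrite exprMn ler_pM ?exprn_ge0 ?(ltW k0) ?(ltW N0)//.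
      by rewrite -[leRHS]expr1 ler_wiXn2l ?(ltW k0)// ltnW.
    by rewrite ler_weXn2l// -ltnS (leq_trans id).
  have hx0 : `|xi i0| ^+ i <= kap * N ^+ e * W ^+ i.
    apply: (@le_trans _ _ ((M * W) ^+ i)).
      by rewrite lerXn2r ?nnegrE// (le_trans _ x0).
    by rewrite exprMn ler_wpM2r// exprn_ge0// ltW.
  apply: (@le_trans _ _ (kap * N ^+ e * W ^+ i * (C * W ^+ (k - i)))).
    by rewrite ler_pM// exprn_ge0.
  rewrite [leLHS](_ : _ = C * (kap * N ^+ e) * (W ^+ i * W ^+ (k - i))); last by ring.
  by rewrite ler_wpM2l ?Wk// !mulr_ge0 ?exprn_ge0// ltW.
exists (C * Am ^+ (k - i)).
  by rewrite mulr_ge0// exprn_ge0// (le_trans ler01).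
move=> kap N M W xi ad.
have [Y1 hx _ _ /andP[_ h0]] := near_packet_bounds ad.
move: ad => [[/andP[k0 k1] N1 /andP[M0 MN] hzM] [W1 x0 xj]].
have N0 : 0 < N by exact: lt_le_trans N1.
have W0 : 0 < W by exact: lt_le_trans W1.
have A0 : 0 < Am by exact: lt_le_trans Am1.
case: hzM => [/hQ0 /(_ i di ik) ->|Md].
  rewrite mpoly.meval0 mulr0 normr0; have := exprn_ge0 e.+2 (ltW W0).
  apply: mulr_ge0; apply: mulr_ge0; last by rewrite mulr_ge0 ?exprn_ge0 ?(ltW k0) ?(ltW N0).
  by rewrite mulr_ge0 ?exprn_ge0 ?(ltW A0).
have hMi : M ^+ i * N ^+ (k - i) <= kap * N ^+ e.
  rewrite -{1}(subnKC di) exprD -mulrA.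
  have hN : M ^+ (i - d) <= N ^+ (i - d).
    have MN1 : M <= N by rewrite (le_trans MN)// ler_piMl// ltW.
    by rewrite lerXn2r ?nnegrE ?(ltW N0).
  apply: (@le_trans _ _ (kap * N ^+ d.-1 * (N ^+ (i - d) * N ^+ (k - i)))).
    rewrite ler_pM ?mulr_ge0 ?exprn_ge0 ?(ltW N0)//.
    by rewrite ler_wpM2r// exprn_ge0// ltW.
  have de : (d.-1 + (i - d + (k - i)) = e)%N.
    exact: (exponent_split (ltnW hd2)).
  by rewrite -mulrA -!exprD de.
have hx0 : `|xi i0| ^+ i <= M ^+ i * W ^+ i.
  by rewrite -exprMn lerXn2r ?nnegrE// (le_trans _ x0).
rewrite normrM normrX.
apply: (@le_trans _ _ (M ^+ i * W ^+ i * (C * (N * Am * W) ^+ (k - i)))).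
  by rewrite ler_pM ?exprn_ge0// hC.
rewrite !exprMn [leLHS](_ : _ = C * Am ^+ (k - i) *
  ((M ^+ i * N ^+ (k - i)) * (W ^+ i * W ^+ (k - i)))); last by ring.
rewrite -[leRHS]mulrA ler_wpM2l ?mulr_ge0 ?exprn_ge0 ?(ltW A0)//.
by rewrite ler_pM ?mulr_ge0 ?exprn_ge0 ?(ltW W0) ?(ltW N0) ?Wk.
Qed.

Lemma phase_error_phase : phase_error (fun N xi =>
  meval xi P - meval (scaled N) P - xi i0 * (N ^+ e * meval a (Q e))).
Proof.
(* The homogeneous parts of degree below k, handled together by [phase_error_low]. *)
pose Rst : mpoly n R := \sum_(i < k) pihomog mdeg i P.
have PE : P = Rst + \sum_(0 <= i < k.+1) var R i0 ^+ i * Q (k - i)%N.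
  have := mpoly.pihomog_partitionE (mf := mdeg) (k := k.+1) (p := P).
  rewrite -hlead /leading_form hP /Rst big_ord_recr; apply.
  by rewrite -hP.
have Rdeg : degree_le e Rst.
  move=> m; apply: contraTT; rewrite -ltnNge => em.
  rewrite mpoly.mcoeff_msupp negbK raddf_sum/= big1// => i _.
  apply: (mpoly.dhomog_nemf_coeff (mpoly.pihomogP _ _ _)).
  by rewrite neq_ltn (leq_trans (ltn_ord i) em) orbT.
have main : forall N xi,
    meval xi P - meval (scaled N) P - xi i0 * (N ^+ e * meval a (Q e)) =
    (meval xi Rst - meval (scaled N) Rst) +
    ((meval xi (Q k) - meval (scaled N) (Q k)) +
    (xi i0 * (meval xi (Q e) - meval (scaled N) (Q e)) +
    \sum_(i <- index_iota 2 k.+1) xi i0 ^+ i * meval xi (Q (k - i)%N))).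
  move=> N xi.
  have ev v : meval v P = meval v Rst + (meval v (Q k) + (v i0 * meval v (Q e) +
      \sum_(2 <= i < k.+1) v i0 ^+ i * meval v (Q (k - i)%N))).
    rewrite {1}PE mpoly.mevalD; congr (_ + _).
    rewrite (raddf_sum (meval v))/= big_ltn// big_ltn//.
    have t i : meval v (var R i0 ^+ i * Q (k - i)%N) = v i0 ^+ i * meval v (Q (k - i)%N).
      by rewrite mpoly.mevalM rmorphXn/= mpoly.mevalXU.
    rewrite !t expr0 mul1r expr1 subn0 subSS subn0; congr (_ + (_ + _)).
    by apply: eq_bigr => i _; rewrite t.
  (* Since the centre has first coordinate 0, only [Rst] and Q_k contribute to P there. *)
  have s0 : scaled N i0 = 0 by rewrite /scaled ha0 mulr0.
  have Qe : meval (scaled N) (Q e) = N ^+ e * meval a (Q e).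
    have [qf _] := hQ (ltn0Sn e); rewrite subSS subn0 in qf.
    exact: meval_form.
  rewrite (ev xi) (ev (scaled N)) s0 mul0r add0r.
  have -> : \sum_(2 <= i < k.+1) 0 ^+ i * meval (scaled N) (Q (k - i)%N) = 0 :> R.
    rewrite big_nat_cond big1// => i /andP[/andP[i2 _] _].
    by rewrite expr0n eqn0Ngt (ltnW i2) mul0r.
  by rewrite Qe; ring.
have hS : phase_error (fun N xi =>
    \sum_(i <- index_iota 2 k.+1) xi i0 ^+ i * meval xi (Q (k - i)%N)).
  apply: (phase_error_sum (T := fun i (_ : R) (xi : 'I_n -> R) =>
    xi i0 ^+ i * meval xi (Q (k - i)%N))) => i.
  by rewrite mem_index_iota ltnS => /andP[i2 ik]; exact: phase_error_Qi.
have [A A0 hA] := phase_errorD (phase_error_low Rdeg)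
  (phase_errorD phase_error_Qk (phase_errorD phase_error_Q1 hS)).
by exists A => // kap N M W xi ad; rewrite main; exact: hA ad.
Qed.

End stationary_phase_proof.

(** The choice of t makes t xi_1 N^e q equal to -x_1 xi_1. What remains is at most kap W for each
    other coordinate, as |x_j| <= 1, plus t times a phase error, at most A kap W^(e+2) / |q|; hence
    the constant n + A / |q|. *)
Lemma phase_error_stationary_phase (R : realType) n e (P : mpoly n R) (Q : nat -> mpoly n R)
    (i0 : 'I_n) (a : 'I_n -> R) d (hz : Prop) p p' :
  a i0 = 0 -> meval a (Q e) != 0 -> (p' <= p)%N ->
  (hz \/ forall kap L : R, 0 < kap <= 1 -> 1 <= L ->
    (kap * L ^+ p') ^+ d <= kap * (L ^+ p) ^+ d.-1) ->
  phase_error e i0 a d hz (fun N xi =>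
    meval xi P - meval (scaled a N) P - xi i0 * (N ^+ e * meval a (Q e))) ->
  exists2 A : R, 0 <= A & stationary_phase P i0 a (meval a (Q e)) e p p' A e.+2.
Proof.
move=> ha0 q0 pp' hM [A A0 hA]; set q := meval a (Q e) in q0 hA *.
exists (n%:R + A / `|q|); first by rewrite addr_ge0 ?divr_ge0.
move=> kap L k01 L1 x xi hx /=.
set N := L ^+ p; set b := [tuple _ | _ < _]; set M := kap * L ^+ p'.
have [k0 k1] := andP k01.
have L0 : 0 < L by exact: lt_le_trans L1.
have N1 : 1 <= N by rewrite exprn_ege1.
have N0 : 0 < N by exact: lt_le_trans N1.
have M0 : 0 < M by rewrite mulr_gt0// exprn_gt0.
pose w := widths i0 kap M.
have w0 j : 0 < w j by rewrite /w /widths; case: ifP.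
pose z j : R := (tnth xi j - tnth b j) / w j.
(* The product dominates each factor 1 + |z_j|, so it serves as the single distance parameter of
   [near_packet]. *)
pose W : R := \prod_(j < n) (1 + `|z j|).
have zW j : 1 + `|z j| <= W.
  rewrite /W (bigD1 j)//= ler_peMr ?addr_ge0//.
  by elim/big_rec: _ => // i y _ y1; rewrite -[leLHS]mulr1 ler_pM// lerDl.
have W1 : 1 <= W by apply: le_trans (zW i0); rewrite lerDl.
have W0 : 0 < W by exact: lt_le_trans W1.
have bE j : tnth b j = N * a j by rewrite tnth_mktuple.
have xz j : tnth xi j - N * a j = w j * z j.
  by rewrite /z bE; field; exact: lt0r_neq0.
have wz j : `|w j * z j| <= w j * W.
  rewrite normrM gtr0_norm// ler_wpM2l ?(ltW (w0 j))//.
  by apply: le_trans (zW j); rewrite lerDr.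
have slow j : j != i0 -> `|tnth xi j - N * a j| <= kap * W.
  by move=> ji; rewrite xz (le_trans (wz j))// /w /widths (negPf ji).
have ad : near_packet i0 a d hz kap N M W (fun j => tnth xi j).
  split; split => //.
  - by rewrite (ltW M0) /M ler_wpM2l ?(ltW k0)// ler_weXn2l.
  - by case: hM => [|hM]; [left|right; exact: hM].
  - have := xz i0; rewrite ha0 mulr0 subr0 => ->.
    by rewrite (le_trans (wz i0))// /w /widths eqxx.
have := hA _ _ _ _ _ ad.
set T := (X in `|X| <= _ -> _) => hT.
set t := - tnth x i0 / (N ^+ e * q).
have Ne0 : 0 < N ^+ e by rewrite exprn_gt0.
have bs : peval P b = meval (scaled a N) P.
  by apply: mpoly.meval_eq => j; rewrite bE.
have E : dot x xi + peval P xi * t - (dot x b + peval P b * t) =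
    \sum_(j < n | j != i0) tnth x j * (tnth xi j - N * a j) + t * T.
  have -> : dot x xi = dot x b + (tnth x i0 * tnth xi i0 +
      \sum_(j < n | j != i0) tnth x j * (tnth xi j - N * a j)).
    have dE : dot x xi - dot x b = \sum_(j < n) tnth x j * (tnth xi j - N * a j).
      by rewrite /dot -sumrB; apply: eq_bigr => j _; rewrite bE mulrBr.
    by rewrite (bigD1 i0)//= ha0 mulr0 subr0 in dE; rewrite -dE addrC subrK.
  rewrite bs /T -/(peval P xi) /t; field.
  by rewrite q0 lt0r_neq0.
rewrite E (le_trans (ler_normD _ _))// -mulrA mulrDl; apply: lerD.
  apply: (@le_trans _ _ (\sum_(j < n) kap * W)).
    apply: (le_trans (ler_norm_sum _ _ _)).
    rewrite big_mkcond/=; apply: ler_sum => j _.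
    case: ifP => ji; last by rewrite mulr_ge0// ltW.
    rewrite normrM -[leRHS]mul1r ler_pM//; exact: slow.
  rewrite sumr_const card_ord -[leLHS]mulr_natl ler_wpM2l// ler_wpM2l ?(ltW k0)//.
  by rewrite -[leLHS]expr1 ler_weXn2l.
rewrite normrM; apply: (@le_trans _ _ ((N ^+ e * `|q|)^-1 * (A * (kap * N ^+ e) * W ^+ e.+2))).
  apply: ler_pM => //; rewrite /t normrM normrN normrV ?unitfE ?mulf_neq0 ?(lt0r_neq0 Ne0)//.
  by rewrite normrM (gtr0_norm Ne0) ler_piMl ?hx// invr_ge0 mulr_ge0 ?(ltW Ne0).
rewrite -/W le_eqVlt; apply/orP; left; apply/eqP.
by field; rewrite normr_eq0 q0 ?lt0r_neq0.
Qed.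

Local Close Scope classical_set_scope.

Theorem theorem1p2 (R : realType) (n k : nat) (hn : (2 <= n)%N) (hk : (2 <= k)%N)
  (P : mpoly n R) (hP : msize P = k.+1)
  (Q : nat -> mpoly n R)
  (hQform : forall i : nat, (i <= k)%N ->
     is_form (k - i) (Q (k - i)%N) /\
     poly_in [set~ first_var hn] (Q (k - i)%N))
  (hlead : leading_form P =
     \sum_(0 <= i < k.+1) var R (first_var hn) ^+ i * Q (k - i)%N)
  (d : nat) (hd2 : (2 <= d)%N) (hdk : (d <= k)%N)
  (Sigma : {set 'I_n}) (hSigma : Sigma \proper [set~ first_var hn])
  (hQSigma : forall i : nat, (2 <= i)%N -> (i <= d.-1)%N ->
     poly_in Sigma (Q (k - i)%N))
  (hQ1 : exists2 m : multinom n,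
     m \in msupp (Q (k - 1)%N) &
     monomial_in ([set~ first_var hn] :\: Sigma) m)
  (s : R) (hmax : exists C : R, maximal_estimate P s C) :
  ((forall i : nat, (d <= i)%N -> (i <= k)%N -> Q (k - i)%N = 0) ->
     1 / 2 <= s) /\
  (~ (forall i : nat, (d <= i)%N -> (i <= k)%N -> Q (k - i)%N = 0) ->
     (d%:R - 1) / (2 * d%:R) <= s).
Proof.
case: k hk hP hQform hlead hdk hQSigma hQ1 => // e e0 hP hQ hlead hdk hQS [m0 m0Q m0S].
have [C hC] := hmax.
set i0 := first_var hn in hQ hlead hSigma m0S *.
rewrite subn1/= in m0Q.
(* The direction of the packet: the given monomial of Q_{k-1} yields a point off [Sigma] and off the
   first variable where Q_{k-1} is nonzero. *)
have [a aS q0] := meval_neq0 m0Q m0S.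
have ha0 : a i0 = 0 by apply: aS; rewrite !inE eqxx andbF.
have haS j : j \in Sigma -> a j = 0 by move=> jS; apply: aS; rewrite !inE jS.
have i0S : i0 \notin Sigma.
  by apply/negP => /(fintype.subsetP (proper_sub hSigma)); rewrite !inE eqxx.
have n0 : (0 < n)%N := ltnW hn.
have base (hz : Prop) p p' :
    (hz -> forall i : nat, (d <= i)%N -> (i <= e.+1)%N -> Q (e.+1 - i)%N = 0) ->
    (hz \/ forall kap L : R, 0 < kap <= 1 -> 1 <= L ->
      (kap * L ^+ p') ^+ d <= kap * (L ^+ p) ^+ d.-1) ->
    (0 < p')%N -> (p' <= p)%N -> p'%:R / (2 * p%:R) <= s.
  move=> hQ0 hM p'0 pp'.
  have [A A0 hA] := phase_error_stationary_phase ha0 q0 pp' hM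
    (phase_error_phase hP hQ hlead hd2 hdk hQS hQ0 ha0 haS i0S).
  exact: necessary_condition n0 e0 p'0 pp' q0 A0 hA hC.
split=> [hQ0|_].
  (* N = L and M = kap L, so p'/(2p) = 1/2. *)
  by have := base _ 1%N 1%N (fun _ => hQ0) (or_introl I); rewrite mulr1; apply.
have d0 : (0 < d)%N by exact: leq_trans hd2.
rewrite -(natrB R d0) subn1.
(* N = L^d and M = kap L^(d-1): both sides of the condition on M carry L^(d(d-1)), and it reduces to
   kap^d <= kap. *)
apply: (base False) => //; [right|by rewrite -ltnS prednK|exact: leq_pred].
move=> kap L /andP[k0 k1] L1; rewrite exprMn -!exprM mulnC ler_wpM2r//.
  by rewrite exprn_ge0// (le_trans ler01).
by rewrite -[leRHS]expr1 ler_wiXn2l// ltW.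
Qed.
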